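(* Let $z,z'$ be parameters of the principal or complementary series and let $K(x,y)$ be the Whittaker kernel on $(0,+\infty)$ with parameters $z,z'$. For arbitrary $\tau>0$, the integral operator with the Whittaker kernel restricted to the semi-infinite interval $(\tau,+\infty)$ commutes with the Sturm--Liouville differential operator $Df=(pf')'+qf$, where $$p(x)=x(x-\tau),\qquad q(x)=-\frac{\big((a-x/2)^2-t\big)(x-\tau)}{x},\qquad a=\frac{z+z'}2,\quad t=zz'.$$
   Context: Parameters: the principal series consists of $z\in\mathbb{C}\setminus\mathbb{Z}$, $z'=\bar z$; the complementary series consists of real $z,z'$ such that $m<z,z'<m+1$ for some $m\in\mathbb{Z}$. The Whittaker kernel is $$K(x,y)=\frac{(xy)^{-1/2}}{\Gamma(z)\Gamma(z')}\cdot\frac{W_{\kappa,\mu}(x)W_{\kappa-1,\mu}(y)-W_{\kappa,\mu}(y)W_{\kappa-1,\mu}(x)}{x-y},\qquad x,y>0,$$ with $\kappa=\frac{z+z'+1}2$, $\mu=\frac{z-z'}2$, extended to $x=y$ by continuity, where $W_{\kappa,\mu}$ is the Whittaker function (the solution of $W''=\left(\frac14-\frac{\kappa}{x}+\frac{\mu^2-1/4}{x^2}\right)W$ on $x>0$ with $W_{\kappa,\mu}(x)\sim x^{\kappa}e^{-x/2}$ as $x\to+\infty$). The restricted integral operator is $(K_\tau f)(x)=\int_\tau^{+\infty}K(x,y)f(y)\,dy$. Commutation means $K_\tau Df=DK_\tau f$ for all $f\in C^2([\tau,+\infty))$ vanishing for all sufficiently large $x$. *)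

(* Defs.v *)
From Stdlib Require Import Reals ZArith.
From Coquelicot Require Import Coquelicot.
Open Scope R_scope.

(* Complex-valued functions of a real variable are handled in the real Banach
   space C_R_CompleteNormedModule. *)

Definition Cexp (w : C) : C :=
  (exp (fst w) * cos (snd w), exp (fst w) * sin (snd w)).

(* x^w = exp (w * ln x), principal branch; meaningful for x > 0 only. *)
Definition Rcpow (x : R) (w : C) : C := Cexp (w * RtoC (ln x))%C.

(* w (w + 1) ... (w + n), with n + 1 factors. *)
Fixpoint rising (w : C) (n : nat) : C :=
  match n with
  | O => w
  | S m => (rising w m * (w + RtoC (INR n)))%C
  end.

(* Gauss's limit n! n^w / (w (w + 1) ... (w + n)), for w not in {0, -1, ...}. *)
Definition Cgamma (w : C) : C :=
  @iota C_R_CompleteNormedModule (fun l : C =>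
    filterlim
      (fun n : nat => (RtoC (INR (fact n)) * Rcpow (INR n) w / rising w n)%C : C_R_NormedModule)
      eventually (locally (T := C_R_NormedModule) l)).

Definition principal_series (z z' : C) : Prop :=
  (forall m : Z, z <> RtoC (IZR m)) /\ z' = Cconj z.

Definition complementary_series (z z' : C) : Prop :=
  exists (x x' : R) (m : Z),
    z = RtoC x /\ z' = RtoC x' /\
    IZR m < x < IZR m + 1 /\ IZR m < x' < IZR m + 1.

(* The asymptotics at infinity select the recessive solution, so at most one
   function on (0, +oo) satisfies this; values at x <= 0 are irrelevant. *)
Definition is_whittaker (kappa mu : C) (W : R -> C) : Prop :=
  (exists W1 : R -> C, forall x : R, 0 < x ->
     @is_derive R_AbsRing C_R_NormedModule W x (W1 x) /\
     @is_derive R_AbsRing C_R_NormedModule W1 x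
       ((RtoC (1 / 4) - kappa / RtoC x
         + (mu * mu - RtoC (1 / 4)) / RtoC (x ^ 2)) * W x)%C) /\
  filterlim
    (fun x : R =>
       (W x / (Rcpow x kappa * RtoC (exp (- x / 2))))%C : C_R_NormedModule)
    (Rbar_locally p_infty) (locally (T := C_R_NormedModule) (RtoC 1)).

Definition kappa_of (z z' : C) : C := ((z + z' + RtoC 1) / RtoC 2)%C.
Definition mu_of (z z' : C) : C := ((z - z') / RtoC 2)%C.

Section Kernel.
(* W kappa mu : R -> C stands for the function W_{kappa,mu}. *)
Variables (W : C -> C -> R -> C) (z z' : C).
Let kappa := kappa_of z z'.
Let mu := mu_of z z'.

Definition whittaker_kernel_offdiag (x y : R) : C :=
  (RtoC (/ sqrt (x * y)) / (Cgamma z * Cgamma z')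
   * ((W kappa mu x * W (kappa - RtoC 1) mu y
       - W kappa mu y * W (kappa - RtoC 1) mu x) / RtoC (x - y)))%C.

Definition whittaker_kernel (x y : R) : C :=
  if Req_EM_T x y
  then @iota C_R_CompleteNormedModule (fun l : C =>
         filterlim (fun s : R => whittaker_kernel_offdiag x s : C_R_NormedModule)
           (locally' x) (locally (T := C_R_NormedModule) l))
  else whittaker_kernel_offdiag x y.
End Kernel.

(* Derivative at x within [tau, +oo): one-sided at x = tau, and the usual one
   for x > tau. *)
Definition is_derive_from (tau : R) (f : R -> C) (x : R) (l : C) : Prop :=
  @filterdiff R_AbsRing R_NormedModule C_R_NormedModule
    f (within (Rle tau) (locally x))
    (fun y : R => @scal R_Ring C_R_ModuleSpace y l).

Definition Derive_from (tau : R) (f : R -> C) (x : R) : C :=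
  @iota C_R_CompleteNormedModule (is_derive_from tau f x).

Definition C2_from (tau : R) (f : R -> C) : Prop :=
  exists f1 f2 : R -> C, forall x : R, tau <= x ->
    is_derive_from tau f x (f1 x) /\
    is_derive_from tau f1 x (f2 x) /\
    filterlim (f2 : R -> C_R_NormedModule) (within (Rle tau) (locally x))
      (locally (T := C_R_NormedModule) (f2 x)).

Definition sturm_liouville (tau : R) (p q : R -> C) (f : R -> C) (x : R) : C :=
  (Derive_from tau (fun y => p y * Derive_from tau f y) x + q x * f x)%C.

Section RestrictedOperator.
Variables (tau : R) (K : R -> R -> C).

Definition restricted_op (f : R -> C) (x : R) : C :=
  @RInt_gen C_R_CompleteNormedModule (fun y : R => (K x y * f y)%C)
    (at_point tau) (Rbar_locally p_infty).

Definition restricted_op_defined (f : R -> C) : Prop :=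
  forall x : R, tau <= x ->
    @ex_RInt_gen C_R_NormedModule (fun y : R => (K x y * f y)%C)
      (at_point tau) (Rbar_locally p_infty).

(* The operators above are total, with junk values where an integral or a
   derivative does not exist; the first three conjuncts say that both sides of
   the last one are genuine. *)
Definition commutes_with_sturm_liouville (p q : R -> C) : Prop :=
  forall f : R -> C,
    C2_from tau f -> Rbar_locally p_infty (fun x => f x = RtoC 0) ->
    restricted_op_defined f /\
    restricted_op_defined (sturm_liouville tau p q f) /\
    C2_from tau (restricted_op f) /\
    forall x : R, tau <= x ->
      restricted_op (sturm_liouville tau p q f) x
      = sturm_liouville tau p q (restricted_op f) x.
End RestrictedOperator.

(* Main.v *)
Require Import Defs.
From Stdlib Require Import Reals Lra.
From Coquelicot Require Import Coquelicot.
Open Scope R_scope.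

(** [kappa], [mu^2] and [t] are real, so a Wronskian argument shows that the two
    Whittaker functions are real and satisfy the contiguity relation
    [x W1' = (x/2 - kappa + 1) W1 - W0].  Hence [A = W0 / sqrt x], [B = W1 / sqrt x]
    solve [x A' = (a - x/2) A + t B], [x B' = - (a - x/2) B - A], and the kernel is a
    constant times [k(x,y) = (A(x) B(y) - B(x) A(y)) / (x - y)].  The first order system
    gives [D_x k = D_y k]; Green's formula then moves [D] from [k] to [f], since the
    leading coefficient [x (x - tau)] of [D] vanishes at the endpoint [tau].  Smoothness of
    [k] across the diagonal comes from writing the divided differences of [A] and [B] as
    integrals over a segment. *)

(** * Divided differences and integrals with a parameter *)

(** A Whittaker function is given only by its equation and its leading asymptotics, which say
    nothing about its derivative. Decay of the derivative is therefore recovered from the equation,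
    and a Wronskian then shows that every solution bounded together with its derivative near
    infinity is a multiple of the recessive one. Contiguity is an instance:
    [x W1' - (x/2 - kappa + 1) W1] solves the equation of [W0] and stays bounded, so it equals
    [d W0]; and [d = -1], because [W1 / (x^(kappa-1) exp(-x/2))] converges while its derivative
    tends to [1 + d]. The identities for the kernel are stated multiplied by [x - y], so that they
    hold on the diagonal too. Functions that are [C^2] only up to the endpoint [tau] are extended to
    the whole line, after which all calculus is two-sided and real; real and imaginary parts are
    recombined at the end. *)

Lemma continuous_of_is_derive (f f' : R -> R) (x : R) :
  is_derive f x (f' x) -> continuous f x.
Proof. intros H. apply (ex_derive_continuous (V := R_NormedModule)). now exists (f' x). Qed.

Lemma locally_pos (x : R) : 0 < x -> locally x (fun u => 0 < u).
Proof. intros Hx. apply (open_gt 0 x Hx). Qed.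

Lemma continuous_Rplus (f g : R -> R) (x : R) :
  continuous f x -> continuous g x -> continuous (fun u => f u + g u) x.
Proof. apply (continuous_plus (V := R_NormedModule)). Qed.

Lemma continuous_Rminus (f g : R -> R) (x : R) :
  continuous f x -> continuous g x -> continuous (fun u => f u - g u) x.
Proof. apply (continuous_minus (V := R_NormedModule)). Qed.

Lemma continuous_Rmult (f g : R -> R) (x : R) :
  continuous f x -> continuous g x -> continuous (fun u => f u * g u) x.
Proof. apply (continuous_mult (K := R_AbsRing)). Qed.

Lemma locally_2d_pos (x y : R) :
  0 < x -> 0 < y -> locally_2d (fun u v => 0 < u /\ 0 < v) x y.
Proof.
  intros Hx Hy.
  assert (Hm : 0 < Rmin x y) by now apply Rmin_pos.
  exists (mkposreal _ Hm); simpl; intros u v Hu Hv.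
  pose proof (Rmin_l x y); pose proof (Rmin_r x y).
  apply Rabs_lt_between' in Hu; apply Rabs_lt_between' in Hv. lra.
Qed.

Lemma continuity_2d_pt_section_r (f : R -> R -> R) (x y : R) :
  continuity_2d_pt f x y -> continuous (fun v => f x v) y.
Proof.
  intros H. apply continuity_2d_pt_filterlim in H.
  refine (filterlim_comp _ _ _ (fun v => (x, v)) (fun z => f (fst z) (snd z)) _ _ _ _ H).
  intros P [d Hd]. exists d. intros v Hv. apply Hd. split; [apply ball_center | exact Hv].
Qed.

Lemma continuity_2d_pt_swap (f : R -> R -> R) (x y : R) :
  continuity_2d_pt f y x -> continuity_2d_pt (fun u v => f v u) x y.
Proof.
  intros H eps. destruct (H eps) as [d Hd]. exists d. auto.
Qed.

Lemma continuity_2d_pt_section_l (f : R -> R -> R) (x y : R) :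
  continuity_2d_pt f x y -> continuous (fun u => f u y) x.
Proof.
  intros H. apply (continuity_2d_pt_section_r (fun u v => f v u)).
  now apply continuity_2d_pt_swap.
Qed.

Lemma continuity_2d_pt_comp_1d (g : R -> R) (h : R -> R -> R) (x y : R) :
  continuous g (h x y) -> continuity_2d_pt h x y ->
  continuity_2d_pt (fun u v => g (h u v)) x y.
Proof.
  intros Hg Hh. apply continuity_1d_2d_pt_comp; [|exact Hh].
  now apply continuity_pt_filterlim.
Qed.

(** The general theorem on differentiation under the integral asks for joint continuity of [Derive].
    The third hypothesis, local in both variables, transfers continuity from the explicit derivative
    [fx]. *)
Lemma is_derive_RInt_param_2d (f fx : R -> R -> R) (a b x : R) :
  a <= b ->
  locally x (fun u => forall t, a <= t <= b -> is_derive (fun z => f z t) u (fx u t)) ->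
  (forall t, a <= t <= b ->
     locally_2d (fun u v => is_derive (fun z => f z v) u (fx u v)) x t) ->
  (forall t, a <= t <= b -> continuity_2d_pt fx x t) ->
  locally x (fun u => ex_RInt (f u) a b) ->
  is_derive (fun u => RInt (f u) a b) x (RInt (fx x) a b).
Proof.
  intros Hab Hd Hd2 Hc Hi.
  assert (E : RInt (fx x) a b = RInt (fun t => Derive (fun u => f u t) x) a b).
  { apply RInt_ext. intros t Ht. rewrite Rmin_left, Rmax_right in Ht by exact Hab.
    symmetry. apply is_derive_unique.
    apply (locally_singleton _ _ Hd). lra. }
  rewrite E.
  apply (is_derive_RInt_param f a b x).
  - revert Hd. apply filter_imp. intros u Hu t Ht.
    rewrite Rmin_left, Rmax_right in Ht by exact Hab.
    exists (fx u t). now apply Hu.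
  - intros t Ht. rewrite Rmin_left, Rmax_right in Ht by exact Hab.
    apply continuity_2d_pt_ext_loc with fx.
    + generalize (Hd2 t Ht). apply locally_2d_impl.
      apply locally_2d_forall. intros u v Huv. symmetry. now apply is_derive_unique.
    + now apply Hc.
  - exact Hi.
Qed.

(** For [g = f'] and [j = 0] this is the divided difference [(f x - f y) / (x - y)], also meaningful
    at [x = y]. Each differentiation in [x] brings out a factor [s], so [moment j] of the derivative
    of order [j + 1] is the [j]-th [x]-derivative of that divided difference. *)
Definition moment (j : nat) (g : R -> R) (x y : R) : R :=
  RInt (fun s => s ^ j * g (y + s * (x - y))) 0 1.

Lemma segment_between (lo hi x y s : R) :
  lo < x < hi -> lo < y < hi -> 0 <= s <= 1 -> lo < y + s * (x - y) < hi.
Proof.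
  intros Hx Hy Hs.
  assert (0 <= s * (x - lo)) by (apply Rmult_le_pos; lra).
  assert (0 <= s * (hi - x)) by (apply Rmult_le_pos; lra).
  destruct (Req_dec s 1) as [->|H1]; [lra|].
  assert (0 < (1 - s) * (y - lo)) by (apply Rmult_lt_0_compat; lra).
  assert (0 < (1 - s) * (hi - y)) by (apply Rmult_lt_0_compat; lra).
  split; nra.
Qed.

Lemma segment_pos (x y s : R) : 0 < x -> 0 < y -> 0 <= s <= 1 -> 0 < y + s * (x - y).
Proof.
  intros Hx Hy Hs. apply (segment_between 0 (x + y + 1)); lra.
Qed.

Section Moment.
Variables (g g' : R -> R).
Hypothesis Hg : forall u, 0 < u -> continuous g u.
Hypothesis Hg' : forall u, 0 < u -> continuous g' u.
Hypothesis Dg : forall u, 0 < u -> is_derive g u (g' u).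

Lemma moment_integrand_continuous (j : nat) (x y s : R) :
  0 < y + s * (x - y) -> continuous (fun s => s ^ j * g (y + s * (x - y))) s.
Proof.
  intros H. apply (continuous_mult (K := R_AbsRing)).
  - apply (ex_derive_continuous (V := R_NormedModule)). auto_derive; trivial.
  - apply (continuous_comp (fun s => y + s * (x - y)) g).
    + apply (ex_derive_continuous (V := R_NormedModule)). auto_derive; trivial.
    + now apply Hg.
Qed.

Lemma moment_ex_RInt (j : nat) (x y : R) : 0 < x -> 0 < y ->
  ex_RInt (fun s => s ^ j * g (y + s * (x - y))) 0 1.
Proof.
  intros Hx Hy. apply (ex_RInt_continuous (V := R_CompleteNormedModule)).
  intros s Hs. rewrite Rmin_left, Rmax_right in Hs by lra.
  apply moment_integrand_continuous. now apply segment_pos.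
Qed.

Lemma moment_continuous (j : nat) (x y : R) :
  0 < x -> 0 < y -> continuity_2d_pt (moment j g) x y.
Proof.
  intros Hx Hy eps.
  (* Any segment whose endpoints are within [m] of [x] and [y] stays in the compact [[m, M]], where
     [g] is uniformly continuous. *)
  set (m := Rmin x y / 2). set (M := Rmax x y + m).
  assert (Hm : 0 < m) by (unfold m; pose proof (Rmin_pos x y Hx Hy); lra).
  assert (Bx : 2 * m <= x <= M - m)
    by (unfold M, m; pose proof (Rmin_l x y); pose proof (Rmax_l x y); lra).
  assert (By : 2 * m <= y <= M - m)
    by (unfold M, m; pose proof (Rmin_r x y); pose proof (Rmax_r x y); lra).
  destruct (unifcont_normed_1d g m M
    (fun u Hu => Hg u (Rlt_le_trans _ _ _ Hm (proj1 Hu))) (pos_div_2 eps)) as [d Hd].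
  assert (Hdm : 0 < Rmin d m) by (apply Rmin_pos; [apply cond_pos | exact Hm]).
  exists (mkposreal _ Hdm); simpl; intros u v Hu Hv.
  pose proof (Rmin_l d m); pose proof (Rmin_r d m).
  apply Rabs_lt_between' in Hu; apply Rabs_lt_between' in Hv.
  assert (Pu : 0 < u) by lra. assert (Pv : 0 < v) by lra.
  unfold moment.
  rewrite <- (RInt_minus (V := R_CompleteNormedModule)) by now apply moment_ex_RInt.
  apply Rle_lt_trans with ((1 - 0) * (eps / 2)); [|pose proof (cond_pos eps); lra].
  apply (abs_RInt_le_const
    (fun s => minus (s ^ j * g (v + s * (u - v))) (s ^ j * g (y + s * (x - y))))); [lra| |].
  - apply (ex_RInt_minus (V := R_NormedModule)); now apply moment_ex_RInt.
  - intros s Hs. unfold minus, plus, opp; simpl.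
    replace (s ^ j * g (v + s * (u - v)) + - (s ^ j * g (y + s * (x - y))))
      with (s ^ j * (g (v + s * (u - v)) - g (y + s * (x - y)))) by ring.
    rewrite Rabs_mult.
    assert (Hj : 0 <= s ^ j <= 1).
    { split; [now apply pow_le|]. rewrite <- (pow1 j). now apply pow_incr. }
    rewrite (Rabs_pos_eq (s ^ j)) by apply Hj.
    assert (Hgg : Rabs (g (v + s * (u - v)) - g (y + s * (x - y))) < eps / 2).
    { apply (Hd (y + s * (x - y)) (v + s * (u - v))).
      - assert (m < y + s * (x - y) < M) by (apply segment_between; lra). lra.
      - assert (m < v + s * (u - v) < M) by (apply segment_between; lra). lra.
      - change (Rabs (v + s * (u - v) - (y + s * (x - y))) < d).
        apply Rabs_lt_between.
        (* The displacement of the point with parameter [s] is a convex combination of the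
           displacements of the two endpoints. *)
        replace (v + s * (u - v) - (y + s * (x - y)))
          with ((v - y) + s * ((u - x) - (v - y))) by ring.
        apply segment_between; lra. }
    pose proof (Rabs_pos (g (v + s * (u - v)) - g (y + s * (x - y)))). nra.
Qed.

Lemma is_derive_moment (j : nat) (x y : R) : 0 < x -> 0 < y ->
  is_derive (fun u => moment j g u y) x (moment (S j) g' x y).
Proof.
  intros Hx Hy. unfold moment.
  assert (D : forall u s, 0 < y + s * (u - y) ->
    is_derive (fun z => s ^ j * g (y + s * (z - y))) u (s ^ S j * g' (y + s * (u - y)))).
  { intros u s Hu.
    replace (s ^ S j * g' (y + s * (u - y))) with (s ^ j * (s * g' (y + s * (u - y))))
      by (simpl; ring).
    apply is_derive_scal.
    apply (is_derive_comp (V := R_NormedModule) g (fun z => y + s * (z - y))).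
    - now apply Dg.
    - auto_derive; trivial. ring. }
  apply (is_derive_RInt_param_2d (fun u s => s ^ j * g (y + s * (u - y)))
    (fun u s => s ^ S j * g' (y + s * (u - y)))); [lra| | | |].
  - generalize (locally_pos x Hx). apply filter_imp. intros u Hu s Hs.
    apply D. now apply segment_pos.
  - intros s Hs.
    assert (C : continuity_2d_pt (fun u s => y + s * (u - y)) x s).
    { apply continuity_2d_pt_plus; [apply continuity_2d_pt_const|].
      apply continuity_2d_pt_mult; [apply continuity_2d_pt_id2|].
      apply continuity_2d_pt_minus; [apply continuity_2d_pt_id1|apply continuity_2d_pt_const]. }
    destruct (C (mkposreal _ (segment_pos x y s Hx Hy Hs))) as [d Hd]. exists d.
    intros u v Hu Hv. apply D. specialize (Hd u v Hu Hv). simpl in Hd.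
    apply Rabs_lt_between' in Hd. lra.
  - intros s Hs. apply continuity_2d_pt_mult.
    + apply (continuity_2d_pt_comp_1d (fun s => s ^ S j) (fun _ v => v)).
      * apply (ex_derive_continuous (V := R_NormedModule)). auto_derive; trivial.
      * apply continuity_2d_pt_id2.
    + apply (continuity_2d_pt_comp_1d g').
      * apply Hg'. now apply segment_pos.
      * apply continuity_2d_pt_plus; [apply continuity_2d_pt_const|].
        apply continuity_2d_pt_mult; [apply continuity_2d_pt_id2|].
        apply continuity_2d_pt_minus; [apply continuity_2d_pt_id1|apply continuity_2d_pt_const].
  - generalize (locally_pos x Hx). apply filter_imp. intros u Hu. now apply moment_ex_RInt.
Qed.

(** The fundamental theorem of calculus along the segment from [y] to [x]. *)
Lemma moment_divided_difference (x y : R) : 0 < x -> 0 < y ->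
  moment 0 g' x y * (x - y) = g x - g y.
Proof.
  intros Hx Hy. unfold moment.
  assert (H : is_RInt (fun s => scal (x - y) (g' (y + s * (x - y)))) 0 1
     (minus (g (y + 1 * (x - y))) (g (y + 0 * (x - y))))).
  { apply (is_RInt_derive (V := R_CompleteNormedModule) (fun s => g (y + s * (x - y)))).
    - intros s Hs. rewrite Rmin_left, Rmax_right in Hs by lra.
      apply (is_derive_comp (V := R_NormedModule) g (fun s => y + s * (x - y))).
      + apply Dg. now apply segment_pos.
      + auto_derive; trivial. ring.
    - intros s Hs. rewrite Rmin_left, Rmax_right in Hs by lra.
      apply (continuous_scal_r (V := R_NormedModule) (x - y) (fun s => g' (y + s * (x - y)))).
      apply (continuous_comp (fun s => y + s * (x - y)) g').
      + apply (ex_derive_continuous (V := R_NormedModule)). auto_derive; trivial.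
      + apply Hg'. now apply segment_pos. }
  apply (is_RInt_unique (V := R_CompleteNormedModule)) in H.
  replace (y + 1 * (x - y)) with x in H by ring.
  replace (y + 0 * (x - y)) with y in H by ring.
  change (minus (g x) (g y)) with (g x - g y) in H. rewrite <- H.
  rewrite (RInt_scal (V := R_CompleteNormedModule)).
  - change (RInt (fun s : R => s ^ 0 * g' (y + s * (x - y))) 0 1 * (x - y)
     = (x - y) * RInt (fun s : R => g' (y + s * (x - y))) 0 1).
    rewrite Rmult_comm. f_equal. apply RInt_ext. intros. simpl. ring.
  - apply (ex_RInt_continuous (V := R_CompleteNormedModule)).
    intros s Hs. rewrite Rmin_left, Rmax_right in Hs by lra.
    apply (continuous_comp (fun s => y + s * (x - y)) g').
    + apply (ex_derive_continuous (V := R_NormedModule)). auto_derive; trivial.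
    + apply Hg'. now apply segment_pos.
Qed.

End Moment.

(** * Integral operators with a smooth kernel on a compact interval *)

Lemma continuous_RInt_param (f : R -> R -> R) (a b x : R) :
  a <= b ->
  (forall t, a <= t <= b -> continuity_2d_pt f x t) ->
  locally x (fun u => ex_RInt (f u) a b) ->
  continuous (fun u => RInt (f u) a b) x.
Proof.
  intros Hab Hc Hi. apply filterlim_locally. intros eps.
  (* The [+ 1] keeps the denominator positive when [a = b], and makes the final inequality
     strict. *)
  assert (He : 0 < eps / (b - a + 1)) by (apply Rdiv_lt_0_compat; [apply cond_pos | lra]).
  destruct (uniform_continuity_2d_1d' f a b x Hc (mkposreal _ He)) as [d Hd].
  pose proof (locally_singleton _ _ Hi) as Hix.
  generalize (filter_and _ _ Hi (locally_ball x d)). apply filter_imp.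
  intros u [Hiu Hu].
  assert (Hu' : x - d <= u <= x + d) by (apply Rabs_lt_between' in Hu; lra).
  change (Rabs (RInt (f u) a b - RInt (f x) a b) < eps).
  rewrite <- (RInt_minus (V := R_CompleteNormedModule)) by assumption.
  apply Rle_lt_trans with ((b - a) * (eps / (b - a + 1))).
  - apply (abs_RInt_le_const (fun t => minus (f u t) (f x t))); [exact Hab | |].
    + now apply (ex_RInt_minus (V := R_NormedModule)).
    + intros t Ht. left. pose proof (cond_pos d).
      apply (Hd t x t u); try lra. rewrite Rminus_diag, Rabs_R0. apply cond_pos.
  - pose proof (cond_pos eps). apply Rmult_lt_reg_r with (b - a + 1); [lra|].
    field_simplify; nra.
Qed.

Section IntegralOperator.
Variables (k kx : R -> R -> R) (tau M : R) (h : R -> R).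
Hypothesis Htau : 0 < tau.
Hypothesis HM : tau <= M.
Hypothesis Ck : forall x y, 0 < x -> 0 < y -> continuity_2d_pt k x y.
Hypothesis Ch : forall y, continuous h y.

(** The kernel is an argument so that the same operator serves a kernel and its [x]-derivatives. *)
Definition integral_op (k : R -> R -> R) (h : R -> R) (x : R) : R :=
  RInt (fun y => k x y * h y) tau M.

Lemma integral_op_integrand_continuous (x y : R) : 0 < x -> 0 < y ->
  continuity_2d_pt (fun x y => k x y * h y) x y.
Proof.
  intros Hx Hy. apply continuity_2d_pt_mult; [now apply Ck|].
  apply (continuity_2d_pt_comp_1d h (fun _ v => v)); [apply Ch | apply continuity_2d_pt_id2].
Qed.

Lemma integral_op_ex_RInt (x : R) : 0 < x -> ex_RInt (fun y => k x y * h y) tau M.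
Proof.
  intros Hx. apply (ex_RInt_continuous (V := R_CompleteNormedModule)).
  intros y Hy. rewrite Rmin_left, Rmax_right in Hy by lra.
  apply (continuity_2d_pt_section_r (fun x y => k x y * h y)).
  apply integral_op_integrand_continuous; lra.
Qed.

Lemma integral_op_continuous (x : R) : 0 < x -> continuous (integral_op k h) x.
Proof.
  intros Hx. apply (continuous_RInt_param (fun x y => k x y * h y)); [exact HM| |].
  - intros y Hy. apply integral_op_integrand_continuous; lra.
  - generalize (locally_pos x Hx). apply filter_imp. apply integral_op_ex_RInt.
Qed.

Hypothesis Ckx : forall x y, 0 < x -> 0 < y -> continuity_2d_pt kx x y.
Hypothesis Dk : forall x y, 0 < x -> 0 < y -> is_derive (fun u => k u y) x (kx x y).

Lemma is_derive_integral_op (x : R) : 0 < x ->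
  is_derive (integral_op k h) x (integral_op kx h x).
Proof.
  intros Hx.
  assert (D : forall u y, 0 < u -> 0 < y ->
    is_derive (fun z => k z y * h y) u (kx u y * h y)).
  { intros u y Hu Hy. apply (is_derive_ext (fun z => h y * k z y)); [intros; apply Rmult_comm|].
    rewrite Rmult_comm. apply is_derive_scal. now apply Dk. }
  apply (is_derive_RInt_param_2d (fun x y => k x y * h y) (fun x y => kx x y * h y));
    [exact HM| | | |].
  - generalize (locally_pos x Hx). apply filter_imp. intros u Hu y Hy. apply D; lra.
  - intros y Hy. generalize (locally_2d_pos x y Hx (Rlt_le_trans _ _ _ Htau (proj1 Hy))).
    apply locally_2d_impl, locally_2d_forall. intros u v [Hu Hv]. now apply D.
  - intros y Hy. apply continuity_2d_pt_mult; [apply Ckx; lra|].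
    apply (continuity_2d_pt_comp_1d h (fun _ v => v)); [apply Ch | apply continuity_2d_pt_id2].
  - generalize (locally_pos x Hx). apply filter_imp. apply integral_op_ex_RInt.
Qed.

End IntegralOperator.

(** * Green's formula for a symmetric kernel *)

Section SymmetricCommutation.
Variables (k kx kxx : R -> R -> R) (q : R -> R) (tau M : R) (h h1 h2 : R -> R).
Hypothesis Htau : 0 < tau.
Hypothesis HM : tau <= M.
Hypothesis Ck : forall x y, 0 < x -> 0 < y -> continuity_2d_pt k x y.
Hypothesis Ckx : forall x y, 0 < x -> 0 < y -> continuity_2d_pt kx x y.
Hypothesis Ckxx : forall x y, 0 < x -> 0 < y -> continuity_2d_pt kxx x y.
Hypothesis Dk : forall x y, 0 < x -> 0 < y -> is_derive (fun u => k u y) x (kx x y).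
Hypothesis Dkx : forall x y, 0 < x -> 0 < y -> is_derive (fun u => kx u y) x (kxx x y).
Hypothesis Sk : forall x y, 0 < x -> 0 < y -> k x y = k y x.
Hypothesis Cq : forall x, 0 < x -> continuous q x.

(** This is [D_x k] with [p' = 2 x - tau] expanded. As [k] is symmetric, swapping the arguments
    gives [D_y k], so the hypothesis [SG] below is the identity [D_x k = D_y k]. *)
Definition sturm_liouville_kernel (x y : R) : R :=
  (2 * x - tau) * kx x y + x * (x - tau) * kxx x y + q x * k x y.

Hypothesis SG : forall x y, 0 < x -> 0 < y -> sturm_liouville_kernel x y = sturm_liouville_kernel y x.

Hypothesis Dh : forall y, is_derive h y (h1 y).
Hypothesis Dh1 : forall y, is_derive h1 y (h2 y).
Hypothesis Ch2 : forall y, continuous h2 y.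
Hypothesis HMh : h M = 0.
Hypothesis HMh1 : h1 M = 0.

Definition sturm_liouville_real (y : R) : R := (2 * y - tau) * h1 y + y * (y - tau) * h2 y + q y * h y.

(* Green's formula: the boundary terms vanish at [tau] because of the factor [x - tau]. *)
Lemma integral_op_sturm_liouville (x : R) : 0 < x ->
  is_RInt (fun y => k x y * sturm_liouville_real y) tau M
    ((2 * x - tau) * integral_op tau M kx h x + x * (x - tau) * integral_op tau M kxx h x
      + q x * integral_op tau M k h x).
Proof.
  intros Hx.
  assert (Ch : forall y, continuous h y)
    by (intros y; apply (ex_derive_continuous (V := R_NormedModule)); now exists (h1 y)).
  assert (Ch1 : forall y, continuous h1 y)
    by (intros y; apply (ex_derive_continuous (V := R_NormedModule)); now exists (h2 y)).
  assert (Cp : forall y, continuous (fun y => y * (y - tau)) y)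
    by (intros y; apply (ex_derive_continuous (V := R_NormedModule)); auto_derive; trivial).
  assert (Cp1 : forall y, continuous (fun y => 2 * y - tau) y)
    by (intros y; apply (ex_derive_continuous (V := R_NormedModule)); auto_derive; trivial).
  (* Lagrange's identity: the integrand is the exact derivative of [p (k h' - (d/dy k) h)]. By
     symmetry of [k], the derivative in its second variable is written [kx y x]. *)
  assert (B : is_RInt (fun y => k x y * sturm_liouville_real y - sturm_liouville_kernel y x * h y) tau M
    (minus (M * (M - tau) * (k x M * h1 M - kx M x * h M))
       (tau * (tau - tau) * (k x tau * h1 tau - kx tau x * h tau)))).
  { apply (is_RInt_derive (V := R_CompleteNormedModule)
      (fun y => y * (y - tau) * (k x y * h1 y - kx y x * h y))).
    - intros y Hy. rewrite Rmin_left, Rmax_right in Hy by lra.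
      assert (Hy0 : 0 < y) by lra.
      assert (Dky : is_derive (fun v => k x v) y (kx y x)).
      { apply (is_derive_ext_loc (fun v => k v x)).
        - generalize (locally_pos y Hy0). apply filter_imp. intros v Hv. now apply Sk.
        - now apply Dk. }
      assert (Dkyy := Dkx y x Hy0 Hx).
      assert (Dhy := Dh y). assert (Dh1y := Dh1 y).
      auto_derive.
      + repeat split; eexists; eassumption.
      + replace (Derive (fun v : R => k x v) y) with (kx y x) by (symmetry; now apply is_derive_unique).
        replace (Derive (fun v : R => kx v x) y) with (kxx y x) by (symmetry; now apply is_derive_unique).
        replace (Derive (fun v : R => h v) y) with (h1 y) by (symmetry; now apply is_derive_unique).
        replace (Derive (fun v : R => h1 v) y) with (h2 y) by (symmetry; now apply is_derive_unique).
        unfold sturm_liouville_real, sturm_liouville_kernel. rewrite (Sk x y) by assumption. ring.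
    - intros y Hy. rewrite Rmin_left, Rmax_right in Hy by lra.
      assert (Hy0 : 0 < y) by lra.
      pose proof (continuity_2d_pt_section_l k y x (Ck y x Hy0 Hx)).
      pose proof (continuity_2d_pt_section_r k x y (Ck x y Hx Hy0)).
      pose proof (continuity_2d_pt_section_l kx y x (Ckx y x Hy0 Hx)).
      pose proof (continuity_2d_pt_section_l kxx y x (Ckxx y x Hy0 Hx)).
      unfold sturm_liouville_real, sturm_liouville_kernel.
      apply continuous_Rminus; apply continuous_Rmult; auto;
        apply continuous_Rplus; try apply continuous_Rplus; apply continuous_Rmult; auto. }
  rewrite HMh, HMh1 in B.
  replace (minus (M * (M - tau) * (k x M * 0 - kx M x * 0))
    (tau * (tau - tau) * (k x tau * h1 tau - kx tau x * h tau))) with 0 in B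
    by (unfold minus, plus, opp; simpl; ring).
  assert (I : forall k0, (forall x y, 0 < x -> 0 < y -> continuity_2d_pt k0 x y) ->
    is_RInt (fun y => k0 x y * h y) tau M (integral_op tau M k0 h x)).
  { intros k0 C0. apply (RInt_correct (V := R_CompleteNormedModule)).
    now apply integral_op_ex_RInt. }
  (* Adding the integrals of [kx x y * h y], [kxx x y * h y] and [k x y * h y] with the coefficients
     of [D] at [x] restores the term [D_x k] that Lagrange's identity subtracts in the form
     [D_y k]. *)
  pose proof (is_RInt_plus (V := R_NormedModule) _ _ _ _ _ _ B
   (is_RInt_plus (V := R_NormedModule) _ _ _ _ _ _
    (is_RInt_plus (V := R_NormedModule) _ _ _ _ _ _
      (is_RInt_scal (V := R_NormedModule) _ _ _ (2 * x - tau) _ (I kx Ckx))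
      (is_RInt_scal (V := R_NormedModule) _ _ _ (x * (x - tau)) _ (I kxx Ckxx)))
    (is_RInt_scal (V := R_NormedModule) _ _ _ (q x) _ (I k Ck)))) as T.
  unfold plus, scal in T; simpl in T; unfold mult in T; simpl in T.
  rewrite Rplus_0_l in T.
  revert T. apply is_RInt_ext. intros y Hy.
  rewrite Rmin_left, Rmax_right in Hy by lra.
  rewrite <- (SG x y) by lra. unfold sturm_liouville_kernel.
  apply Rminus_diag_uniq. ring.
Qed.

End SymmetricCommutation.

(** * The integrable kernel *)

Section MomentDerivatives.
Variables (g g1 g2 g3 : R -> R).
Hypothesis D0 : forall x, 0 < x -> is_derive g x (g1 x).
Hypothesis D1 : forall x, 0 < x -> is_derive g1 x (g2 x).
Hypothesis D2 : forall x, 0 < x -> is_derive g2 x (g3 x).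

(** Both sides are the [x]-derivative of [g x - g y], the left one through the product in
    [moment_divided_difference]. No division occurs, so the diagonal is included. *)
Lemma moment_first_derivative (x y : R) : 0 < x -> 0 < y ->
  moment 1 g2 x y * (x - y) + moment 0 g1 x y = g1 x.
Proof.
  intros Hx Hy.
  assert (C1 : forall u, 0 < u -> continuous g1 u)
    by (intros u Hu; apply (continuous_of_is_derive g1 g2); auto).
  assert (C2 : forall u, 0 < u -> continuous g2 u)
    by (intros u Hu; apply (continuous_of_is_derive g2 g3); auto).
  assert (E : is_derive (fun u => moment 0 g1 u y * (u - y)) x (g1 x)).
  { apply (is_derive_ext_loc (fun u => g u - g y)).
    - generalize (locally_pos x Hx). apply filter_imp. intros u Hu.
      symmetry. now apply moment_divided_difference.
    - pose proof (D0 x Hx) as Dx. auto_derive; [now exists (g1 x)|].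
      rewrite Rmult_1_l. now apply is_derive_unique. }
  pose proof (is_derive_moment g1 g2 C1 C2 D1 0 x y Hx Hy) as Dm.
  rewrite <- (is_derive_unique _ _ _ E). symmetry. apply is_derive_unique.
  auto_derive; [now exists (moment 1 g2 x y)|].
  replace (Derive (fun u : R => moment 0 g1 u y) x) with (moment 1 g2 x y)
    by (symmetry; now apply is_derive_unique).
  ring.
Qed.

(** The [x]-derivative of [moment_first_derivative]: each of its two terms contributes one
    [moment 1 g2]. *)
Lemma moment_second_derivative (x y : R) :
  (forall u, 0 < u -> continuous g3 u) -> 0 < x -> 0 < y ->
  moment 2 g3 x y * (x - y) + 2 * moment 1 g2 x y = g2 x.
Proof.
  intros C3 Hx Hy.
  assert (C1 : forall u, 0 < u -> continuous g1 u)
    by (intros u Hu; apply (continuous_of_is_derive g1 g2); auto).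
  assert (C2 : forall u, 0 < u -> continuous g2 u)
    by (intros u Hu; apply (continuous_of_is_derive g2 g3); auto).
  assert (E : is_derive (fun u => moment 1 g2 u y * (u - y) + moment 0 g1 u y) x (g2 x)).
  { apply (is_derive_ext_loc g1).
    - generalize (locally_pos x Hx). apply filter_imp. intros u Hu.
      symmetry. now apply moment_first_derivative.
    - now apply D1. }
  pose proof (is_derive_moment g1 g2 C1 C2 D1 0 x y Hx Hy) as Dm.
  pose proof (is_derive_moment g2 g3 C2 C3 D2 1 x y Hx Hy) as Dm2.
  rewrite <- (is_derive_unique _ _ _ E). symmetry. apply is_derive_unique.
  auto_derive; [split; [now exists (moment 2 g3 x y)|split; [now exists (moment 1 g2 x y)|trivial]]|].
  replace (Derive (fun u : R => moment 0 g1 u y) x) with (moment 1 g2 x y)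
    by (symmetry; now apply is_derive_unique).
  replace (Derive (fun u : R => moment 1 g2 u y) x) with (moment 2 g3 x y)
    by (symmetry; now apply is_derive_unique).
  ring.
Qed.
End MomentDerivatives.

Section IntegrableKernel.
Variables (a t : R) (A B : R -> R).

Definition dA (x : R) : R := ((a - x / 2) * A x + t * B x) / x.
Definition dB (x : R) : R := (- (a - x / 2) * B x - A x) / x.
Hypothesis DA : forall x, 0 < x -> is_derive A x (dA x).
Hypothesis DB : forall x, 0 < x -> is_derive B x (dB x).

(** With [alpha = a - x/2] and [theta = x d/dx], the first order system decouples into
    [theta^2 A = (alpha^2 - t - x/2) A] and [theta^2 B = (alpha^2 - t + x/2) B]. The common part
    [alpha^2 - t] is the one that appears in [q]. *)
Definition ddA (x : R) : R := ((a - x / 2) ^ 2 - t - x / 2) * A x / x ^ 2 - dA x / x.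
Definition ddB (x : R) : R := ((a - x / 2) ^ 2 - t + x / 2) * B x / x ^ 2 - dB x / x.
Definition dddA (x : R) : R :=
  ((- (a - x / 2) - 1 / 2) * A x + ((a - x / 2) ^ 2 - t - x / 2) * dA x) / x ^ 2
  - 2 * ((a - x / 2) ^ 2 - t - x / 2) * A x / x ^ 3 - ddA x / x + dA x / x ^ 2.
Definition dddB (x : R) : R :=
  ((- (a - x / 2) + 1 / 2) * B x + ((a - x / 2) ^ 2 - t + x / 2) * dB x) / x ^ 2
  - 2 * ((a - x / 2) ^ 2 - t + x / 2) * B x / x ^ 3 - ddB x / x + dB x / x ^ 2.

Lemma is_derive_dA (x : R) : 0 < x -> is_derive dA x (ddA x).
Proof.
  intros Hx. pose proof (DA x Hx) as HA. pose proof (DB x Hx) as HB.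
  unfold dA at 1. auto_derive.
  - repeat split; try lra; eexists; eassumption.
  - replace (Derive (fun u : R => A u) x) with (dA x) by (symmetry; now apply is_derive_unique).
    replace (Derive (fun u : R => B u) x) with (dB x) by (symmetry; now apply is_derive_unique).
    unfold ddA, dA, dB. field. lra.
Qed.

Lemma is_derive_dB (x : R) : 0 < x -> is_derive dB x (ddB x).
Proof.
  intros Hx. pose proof (DA x Hx) as HA. pose proof (DB x Hx) as HB.
  unfold dB at 1. auto_derive.
  - repeat split; try lra; eexists; eassumption.
  - replace (Derive (fun u : R => A u) x) with (dA x) by (symmetry; now apply is_derive_unique).
    replace (Derive (fun u : R => B u) x) with (dB x) by (symmetry; now apply is_derive_unique).
    unfold ddB, dA, dB. field. lra.
Qed.

Lemma is_derive_ddA (x : R) : 0 < x -> is_derive ddA x (dddA x).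
Proof.
  intros Hx. pose proof (DA x Hx) as HA. pose proof (is_derive_dA x Hx) as HA1.
  unfold ddA at 1. auto_derive.
  - repeat split; try eexists; try eassumption; nra.
  - replace (Derive (fun u : R => A u) x) with (dA x) by (symmetry; now apply is_derive_unique).
    replace (Derive (fun u : R => dA u) x) with (ddA x) by (symmetry; now apply is_derive_unique).
    unfold dddA. field. lra.
Qed.

Lemma is_derive_ddB (x : R) : 0 < x -> is_derive ddB x (dddB x).
Proof.
  intros Hx. pose proof (DB x Hx) as HA. pose proof (is_derive_dB x Hx) as HA1.
  unfold ddB at 1. auto_derive.
  - repeat split; try eexists; try eassumption; nra.
  - replace (Derive (fun u : R => B u) x) with (dB x) by (symmetry; now apply is_derive_unique).
    replace (Derive (fun u : R => dB u) x) with (ddB x) by (symmetry; now apply is_derive_unique).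
    unfold dddB. field. lra.
Qed.

Lemma continuous_dddA (x : R) : 0 < x -> continuous dddA x.
Proof.
  intros Hx. apply (ex_derive_continuous (V := R_NormedModule)).
  assert (ex_derive A x) by (eexists; now apply DA).
  assert (ex_derive dA x) by (eexists; now apply is_derive_dA).
  assert (ex_derive ddA x) by (eexists; now apply is_derive_ddA).
  unfold dddA. auto_derive.
  repeat split; trivial; try lra; repeat apply Rmult_integral_contrapositive_currified; lra.
Qed.

Lemma continuous_dddB (x : R) : 0 < x -> continuous dddB x.
Proof.
  intros Hx. apply (ex_derive_continuous (V := R_NormedModule)).
  assert (ex_derive B x) by (eexists; now apply DB).
  assert (ex_derive dB x) by (eexists; now apply is_derive_dB).
  assert (ex_derive ddB x) by (eexists; now apply is_derive_ddB).
  unfold dddB. auto_derive.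
  repeat split; trivial; try lra; repeat apply Rmult_integral_contrapositive_currified; lra.
Qed.

(** Comes from [A(x) B(y) - B(x) A(y) = (A(x) - A(y)) B(y) - (B(x) - B(y)) A(y)] divided by [x - y].
    Since [x] enters only through the moments, [kern1] and [kern2] are the successive
    [x]-derivatives. *)
Definition kern (x y : R) : R := moment 0 dA x y * B y - moment 0 dB x y * A y.
Definition kern1 (x y : R) : R := moment 1 ddA x y * B y - moment 1 ddB x y * A y.
Definition kern2 (x y : R) : R := moment 2 dddA x y * B y - moment 2 dddB x y * A y.

Let CA : forall x, 0 < x -> continuous A x.
Proof. intros x Hx. apply (continuous_of_is_derive A dA). auto. Qed.
Let CB : forall x, 0 < x -> continuous B x.
Proof. intros x Hx. apply (continuous_of_is_derive B dB). auto. Qed.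
Let CdA : forall x, 0 < x -> continuous dA x.
Proof. intros x Hx. apply (continuous_of_is_derive dA ddA), is_derive_dA, Hx. Qed.
Let CdB : forall x, 0 < x -> continuous dB x.
Proof. intros x Hx. apply (continuous_of_is_derive dB ddB), is_derive_dB, Hx. Qed.
Let CddA : forall x, 0 < x -> continuous ddA x.
Proof. intros x Hx. apply (continuous_of_is_derive ddA dddA), is_derive_ddA, Hx. Qed.
Let CddB : forall x, 0 < x -> continuous ddB x.
Proof. intros x Hx. apply (continuous_of_is_derive ddB dddB), is_derive_ddB, Hx. Qed.

Lemma kern_offdiag (x y : R) : 0 < x -> 0 < y -> kern x y * (x - y) = A x * B y - B x * A y.
Proof.
  intros Hx Hy. unfold kern.
  pose proof (moment_divided_difference A dA CdA DA x y Hx Hy).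
  pose proof (moment_divided_difference B dB CdB DB x y Hx Hy). nra.
Qed.

Lemma kern1_offdiag (x y : R) : 0 < x -> 0 < y ->
  kern1 x y * (x - y) + kern x y = dA x * B y - dB x * A y.
Proof.
  intros Hx Hy. unfold kern, kern1.
  rewrite <- (moment_first_derivative A dA ddA dddA DA is_derive_dA is_derive_ddA x y Hx Hy).
  rewrite <- (moment_first_derivative B dB ddB dddB DB is_derive_dB is_derive_ddB x y Hx Hy).
  ring.
Qed.

Lemma kern2_offdiag (x y : R) : 0 < x -> 0 < y ->
  kern2 x y * (x - y) + 2 * kern1 x y = ddA x * B y - ddB x * A y.
Proof.
  intros Hx Hy. unfold kern1, kern2.
  rewrite <- (moment_second_derivative A dA ddA dddA DA is_derive_dA is_derive_ddA x y
    continuous_dddA Hx Hy).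
  rewrite <- (moment_second_derivative B dB ddB dddB DB is_derive_dB is_derive_ddB x y
    continuous_dddB Hx Hy).
  ring.
Qed.

Lemma kern_sym (x y : R) : 0 < x -> 0 < y -> kern x y = kern y x.
Proof.
  intros Hx Hy. destruct (Req_dec x y) as [->|Hxy]; [reflexivity|].
  pose proof (kern_offdiag x y Hx Hy). pose proof (kern_offdiag y x Hy Hx).
  apply Rmult_eq_reg_r with (x - y); lra.
Qed.

(** The diagonal is trivial. Off it, the product identities can be solved for the kernel and its
    derivatives; the system then reduces everything to a rational identity in [x], [y] and the
    values of [A] and [B] at these two points. *)
Lemma sturm_liouville_kernel_kern_sym (tau : R) (x y : R) : 0 < x -> 0 < y ->
  let G := sturm_liouville_kernel kern kern1 kern2 (fun x => - ((a - x / 2) ^ 2 - t) * (x - tau) / x) tau in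
  G x y = G y x.
Proof.
  intros Hx Hy G. destruct (Req_dec x y) as [->|Hxy]; [reflexivity|].
  assert (E : forall u v, 0 < u -> 0 < v -> u <> v ->
    kern u v = (A u * B v - B u * A v) / (u - v) /\
    kern1 u v = (dA u * B v - dB u * A v - kern u v) / (u - v) /\
    kern2 u v = (ddA u * B v - ddB u * A v - 2 * kern1 u v) / (u - v)).
  { intros u v Hu Hv Huv.
    rewrite <- kern_offdiag, <- kern1_offdiag, <- kern2_offdiag by assumption.
    repeat split; field; lra. }
  destruct (E x y Hx Hy Hxy) as (E0 & E1 & E2).
  destruct (E y x Hy Hx (not_eq_sym Hxy)) as (F0 & F1 & F2).
  unfold G, sturm_liouville_kernel.
  (* The order matters: [kern2] is expressed through [kern1], and [kern1] through [kern]. *)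
  rewrite E2, F2, E1, F1, E0, F0. unfold ddA, ddB, dA, dB.
  field. repeat split; lra.
Qed.

(** Serves [kern], [kern1] and [kern2] with [j = 0, 1, 2]. Here [g'] is simply the function paired
    with [A], not the derivative of [g]. *)
Lemma kern_form_continuous (j : nat) (g g' : R -> R) (x y : R) :
  (forall u, 0 < u -> continuous g u) -> (forall u, 0 < u -> continuous g' u) ->
  0 < x -> 0 < y ->
  continuity_2d_pt (fun x y => moment j g x y * B y - moment j g' x y * A y) x y.
Proof.
  intros Hg Hg' Hx Hy.
  apply continuity_2d_pt_minus; apply continuity_2d_pt_mult.
  - now apply moment_continuous.
  - apply (continuity_2d_pt_comp_1d B (fun _ v => v)); [now apply CB | apply continuity_2d_pt_id2].
  - now apply moment_continuous.
  - apply (continuity_2d_pt_comp_1d A (fun _ v => v)); [now apply CA | apply continuity_2d_pt_id2].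
Qed.

Lemma kern_form_is_derive (j : nat) (g g' f f' : R -> R) (x y : R) :
  (forall u, 0 < u -> is_derive g u (g' u)) -> (forall u, 0 < u -> is_derive f u (f' u)) ->
  (forall u, 0 < u -> continuous g' u) -> (forall u, 0 < u -> continuous f' u) ->
  0 < x -> 0 < y ->
  is_derive (fun x => moment j g x y * B y - moment j f x y * A y) x
    (moment (S j) g' x y * B y - moment (S j) f' x y * A y).
Proof.
  intros Dg Df Hg Hf Hx Hy.
  assert (D1 := is_derive_moment g g' (fun u Hu => continuous_of_is_derive g g' u (Dg u Hu))
    Hg Dg j x y Hx Hy).
  assert (D2 := is_derive_moment f f' (fun u Hu => continuous_of_is_derive f f' u (Df u Hu))
    Hf Df j x y Hx Hy).
  auto_derive.
  - repeat split; eexists; eassumption.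
  - replace (Derive (fun u : R => moment j g u y) x) with (moment (S j) g' x y)
      by (symmetry; now apply is_derive_unique).
    replace (Derive (fun u : R => moment j f u y) x) with (moment (S j) f' x y)
      by (symmetry; now apply is_derive_unique).
    ring.
Qed.

End IntegrableKernel.

(** * Recessive solutions of Whittaker's equation *)

Lemma nondecreasing_of_derivative_nonneg (f f' : R -> R) (a b : R) :
  a <= b -> (forall x, a <= x <= b -> is_derive f x (f' x)) ->
  (forall x, a <= x <= b -> 0 <= f' x) -> f a <= f b.
Proof.
  intros Hab D P.
  destruct (MVT_gen f a b f') as (c & Hc & E).
  - intros x Hx. rewrite Rmin_left, Rmax_right in Hx by exact Hab. apply D. lra.
  - intros x Hx. rewrite Rmin_left, Rmax_right in Hx by exact Hab.
    apply continuity_pt_filterlim, (continuous_of_is_derive f f'), D. lra.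
  - rewrite Rmin_left, Rmax_right in Hc by exact Hab. specialize (P c Hc). nra.
Qed.

Lemma mean_value (f f' : R -> R) (a b : R) :
  a < b -> (forall x, a <= x <= b -> is_derive f x (f' x)) ->
  exists c, a <= c <= b /\ f b - f a = f' c * (b - a).
Proof.
  intros Hab D. destruct (MVT_gen f a b f') as (c & Hc & E).
  - intros x Hx. rewrite Rmin_left, Rmax_right in Hx by lra. apply D. lra.
  - intros x Hx. rewrite Rmin_left, Rmax_right in Hx by lra.
    apply continuity_pt_filterlim, (continuous_of_is_derive f f'), D. lra.
  - rewrite Rmin_left, Rmax_right in Hc by lra. now exists c.
Qed.

(** The parameter [c] stands for [mu^2 - 1/4]. *)
Definition whit_pot (k c x : R) : R := 1 / 4 - k / x + c / x ^ 2.

Definition whit_weight (k x : R) : R := exp (k * ln x) * exp (- x / 2).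

Definition whit_solution (k c : R) (u u1 : R -> R) : Prop :=
  forall x, 0 < x -> is_derive u x (u1 x) /\ is_derive u1 x (whit_pot k c x * u x).

(** The limit is left free: it is [1] for the real part of a Whittaker function and [0] for the
    imaginary part. *)
Definition whit_asymp (k : R) (u : R -> R) (l : R) : Prop :=
  filterlim (fun x => u x / whit_weight k x) (Rbar_locally p_infty) (locally l).

Lemma whit_weight_pos (k x : R) : 0 < whit_weight k x.
Proof. apply Rmult_lt_0_compat; apply exp_pos. Qed.

Lemma whit_pot_bound (k c x0 x : R) : 0 < x0 -> x0 <= x ->
  Rabs (whit_pot k c x) <= 1 / 4 + Rabs k / x0 + Rabs c / x0 ^ 2.
Proof.
  intros H0 Hx. unfold whit_pot.
  assert (Hk : Rabs (k / x) <= Rabs k / x0).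
  { unfold Rdiv. rewrite Rabs_mult, (Rabs_pos_eq (/ x))
      by (left; apply Rinv_0_lt_compat; lra).
    apply Rmult_le_compat_l; [apply Rabs_pos|]. apply Rinv_le_contravar; lra. }
  assert (Hc : Rabs (c / x ^ 2) <= Rabs c / x0 ^ 2).
  { unfold Rdiv. rewrite Rabs_mult, (Rabs_pos_eq (/ x ^ 2))
      by (left; apply Rinv_0_lt_compat; nra).
    apply Rmult_le_compat_l; [apply Rabs_pos|]. apply Rinv_le_contravar; nra. }
  apply Rabs_le_between in Hk. apply Rabs_le_between in Hc. apply Rabs_le. lra.
Qed.

(* Gronwall: [(u^2 + u1^2) exp (m x)] is nondecreasing for [m] large and vanishes at [X]. *)
Lemma whit_solution_zero (k c X : R) (u u1 : R -> R) :
  0 < X -> whit_solution k c u u1 -> u X = 0 -> u1 X = 0 ->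
  forall x, 0 < x <= X -> u x = 0.
Proof.
  intros HX S E0 E1 x Hx.
  (* On [[x, X]] the potential is at most [m - 1] in absolute value, so [1 + whit_pot k c y] lies in
     [[-m, m]]. *)
  set (m := 1 + (1 / 4 + Rabs k / x + Rabs c / x ^ 2)).
  assert (H : (u x ^ 2 + u1 x ^ 2) * exp (m * x) <= (u X ^ 2 + u1 X ^ 2) * exp (m * X)).
  { apply (nondecreasing_of_derivative_nonneg
      (fun y => (u y ^ 2 + u1 y ^ 2) * exp (m * y))
      (fun y => (2 * u y * u1 y * (1 + whit_pot k c y) + m * (u y ^ 2 + u1 y ^ 2))
                * exp (m * y))); [lra| |].
    - intros y Hy. destruct (S y) as [D0 D1]; [lra|]. auto_derive.
      + repeat split; eexists; eassumption.
      + replace (Derive (fun v : R => u v) y) with (u1 y)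
          by (symmetry; now apply is_derive_unique).
        replace (Derive (fun v : R => u1 v) y) with (whit_pot k c y * u y)
          by (symmetry; now apply is_derive_unique).
        ring.
    - intros y Hy. apply Rmult_le_pos; [|left; apply exp_pos].
      pose proof (whit_pot_bound k c x y (proj1 Hx) (proj1 Hy)) as B.
      apply Rabs_le_between in B.
      assert (Bm : - m <= 1 + whit_pot k c y <= m).
      { assert (0 <= Rabs k / x) by (apply Rdiv_le_0_compat; [apply Rabs_pos|lra]).
        assert (0 <= Rabs c / x ^ 2) by (apply Rdiv_le_0_compat; [apply Rabs_pos|nra]).
        unfold m. lra. }
      set (s := 1 + whit_pot k c y) in *.
      (* Half the sum of this term and the next is [2 s u u1 + m (u^2 + u1^2)], the factor whose
         sign is wanted. *)
      assert (0 <= (m - s) * (u y - u1 y) ^ 2) by (apply Rmult_le_pos; [lra|apply pow2_ge_0]).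
      assert (0 <= (m + s) * (u y + u1 y) ^ 2) by (apply Rmult_le_pos; [lra|apply pow2_ge_0]).
      nra. }
  rewrite E0, E1 in H. pose proof (exp_pos (m * x)).
  pose proof (pow2_ge_0 (u x)). pose proof (pow2_ge_0 (u1 x)).
  assert (u x ^ 2 + u1 x ^ 2 <= 0) by nra.
  nra.
Qed.

(** The claim amounts to [(k + 2) ln x <= x / 2] for large [x]. The power [2] leaves room for the
    multiplication by [x] in [whit_contiguous]. *)
Lemma whit_weight_decay (k : R) :
  exists X, 1 <= X /\ forall x, X <= x -> whit_weight k x <= / x ^ 2.
Proof.
  assert (L : filterlim (fun y => ln y / y) (Rbar_locally p_infty) (locally 0))
    by exact is_lim_div_ln_p.
  rewrite filterlim_locally in L.
  assert (He : 0 < 1 / (2 * (Rabs (k + 2) + 1)))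
    by (apply Rdiv_lt_0_compat; [lra|]; pose proof (Rabs_pos (k + 2)); lra).
  destruct (L (mkposreal _ He)) as [M HM]. exists (Rmax 1 (M + 1)).
  split; [apply Rmax_l|]. intros x Hx.
  assert (H1 : 1 <= x) by (eapply Rle_trans; [apply Rmax_l|exact Hx]).
  assert (H2 : M < x) by (apply Rlt_le_trans with (M + 1); [lra|];
    eapply Rle_trans; [apply Rmax_r|exact Hx]).
  specialize (HM x H2). change (Rabs (ln x / x - 0) < 1 / (2 * (Rabs (k + 2) + 1))) in HM.
  rewrite Rminus_0_r in HM.
  assert (Hln : 0 <= ln x) by (rewrite <- ln_1; apply ln_le; lra).
  rewrite Rabs_pos_eq in HM by (apply Rdiv_le_0_compat; lra).
  assert (Hk : (k + 2) * ln x <= x / 2).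
  { apply Rle_trans with ((Rabs (k + 2) + 1) * ln x).
    - apply Rmult_le_compat_r; [exact Hln|]. pose proof (Rle_abs (k + 2)). lra.
    - pose proof (Rabs_pos (k + 2)).
      apply Rmult_lt_compat_r with (r := x * (Rabs (k + 2) + 1)) in HM; [|nra].
      field_simplify in HM; lra. }
  assert (Hx2 : x ^ 2 = exp (2 * ln x)).
  { replace (2 * ln x) with (ln x + ln x) by ring. rewrite exp_plus, exp_ln by lra. ring. }
  unfold whit_weight. rewrite Hx2, <- exp_Ropp, <- exp_plus.
  destruct (Rle_lt_or_eq_dec ((k + 2) * ln x) (x / 2) Hk).
  - left. apply exp_increasing. lra.
  - right. f_equal. lra.
Qed.

(* [u' x] is recovered from [u] and [u'' = Q u] on [[x, x + 1]] by the mean value theorem. *)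
Lemma whit_solution_decay (k k' c l : R) (u u1 : R -> R) :
  whit_solution k c u u1 -> whit_asymp k' u l ->
  exists X C, 1 <= X /\ 0 <= C /\
    forall x, X <= x -> Rabs (u x) <= C / x ^ 2 /\ Rabs (u1 x) <= C / x ^ 2.
Proof.
  intros S L. unfold whit_asymp in L. rewrite filterlim_locally in L.
  destruct (L (mkposreal 1 Rlt_0_1)) as [M HM].
  destruct (whit_weight_decay k') as (X & HX1 & HX).
  set (Y := Rmax X (M + 1)). set (C := Rabs l + 1).
  set (q := 1 / 4 + Rabs k / 1 + Rabs c / 1 ^ 2).
  assert (HY : X <= Y /\ M + 1 <= Y) by (split; [apply Rmax_l|apply Rmax_r]).
  assert (HC : 0 < C) by (unfold C; pose proof (Rabs_pos l); lra).
  assert (Hq : 0 <= q).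
  { unfold q. pose proof (Rabs_pos k). pose proof (Rabs_pos c). lra. }
  assert (U : forall x, Y <= x -> Rabs (u x) <= C / x ^ 2).
  { intros x Hx. specialize (HM x ltac:(lra)).
    change (Rabs (u x / whit_weight k' x - l) < 1) in HM.
    pose proof (whit_weight_pos k' x) as Wp.
    assert (Hr : Rabs (u x / whit_weight k' x) <= C).
    { replace (u x / whit_weight k' x) with ((u x / whit_weight k' x - l) + l) by ring.
      eapply Rle_trans; [apply Rabs_triang|]. unfold C. lra. }
    replace (u x) with (u x / whit_weight k' x * whit_weight k' x) by (field; lra).
    rewrite Rabs_mult, (Rabs_pos_eq (whit_weight k' x)) by lra.
    apply Rmult_le_compat; try apply Rabs_pos; try lra. apply HX. lra. }
  assert (Umono : forall x y, Y <= x -> x <= y -> Rabs (u y) <= C / x ^ 2).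
  { intros x y Hx Hxy. eapply Rle_trans; [apply U; lra|].
    apply Rmult_le_compat_l; [lra|]. apply Rinv_le_contravar; nra. }
  (* The [2] bounds [u1 xi = u (x + 1) - u x]; the [q], a bound for the potential on [[1, oo)],
     accounts for the change of [u1] between [x] and [xi]. *)
  exists Y, ((2 + q) * C). split; [lra|]. split; [nra|].
  intros x Hx.
  assert (Hp : 0 < C / x ^ 2) by (apply Rdiv_lt_0_compat; nra).
  split.
  - eapply Rle_trans; [now apply U|]. unfold Rdiv in *. nra.
  - destruct (mean_value u u1 x (x + 1)) as (xi & Hxi & E1); [lra| |].
    { intros y Hy. apply S. lra. }
    assert (E2 : exists eta, x <= eta <= x + 1 /\
      Rabs (u1 xi - u1 x) <= Rabs (whit_pot k c eta * u eta)).
    { destruct (Req_dec x xi) as [<-|Hne].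
      - exists x. split; [lra|]. rewrite Rminus_diag, Rabs_R0. apply Rabs_pos.
      - destruct (mean_value u1 (fun y => whit_pot k c y * u y) x xi) as (eta & He & E); [lra| |].
        + intros y Hy. apply S. lra.
        + exists eta. split; [lra|]. rewrite E, Rabs_mult, (Rabs_pos_eq (xi - x)) by lra.
          pose proof (Rabs_pos (whit_pot k c eta * u eta)). nra. }
    destruct E2 as (eta & He & E2). rewrite Rabs_mult in E2.
    assert (Q := whit_pot_bound k c 1 eta ltac:(lra) ltac:(lra)). fold q in Q.
    assert (Rabs (whit_pot k c eta) * Rabs (u eta) <= q * (C / x ^ 2)).
    { apply Rmult_le_compat; try apply Rabs_pos; [exact Q|]. apply Umono; lra. }
    assert (Ux := U x Hx). assert (Ux1 := Umono x (x + 1) Hx ltac:(lra)).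
    replace ((2 + q) * C / x ^ 2) with (2 * (C / x ^ 2) + q * (C / x ^ 2)) by (unfold Rdiv; ring).
    set (d := C / x ^ 2) in *.
    assert (E2' : Rabs (u1 xi - u1 x) <= q * d) by lra.
    apply Rabs_le_between in Ux. apply Rabs_le_between in Ux1. apply Rabs_le_between in E2'.
    apply Rabs_le. lra.
Qed.

Lemma constant_of_derivative_zero (f : R -> R) :
  (forall x, 0 < x -> is_derive f x 0) -> forall x y, 0 < x -> 0 < y -> f x = f y.
Proof.
  intros D.
  assert (H : forall x y, 0 < x -> x < y -> f x = f y).
  { intros x y Hx Hxy. destruct (mean_value f (fun _ => 0) x y Hxy) as (c & _ & E).
    - intros z Hz. apply D. lra.
    - lra. }
  intros x y Hx Hy. destruct (Rtotal_order x y) as [|[->|]]; auto. symmetry. auto.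
Qed.

(** The Wronskian is constant because the equation has no first order term, and it tends to [0]
    because one solution is bounded with its derivative while the other decays. *)
Lemma whit_wronskian_zero (k c X C Y D : R) (u u1 v v1 : R -> R) :
  whit_solution k c u u1 -> whit_solution k c v v1 -> 1 <= Y -> 0 <= C -> 0 <= D ->
  (forall x, X <= x -> Rabs (u x) <= C /\ Rabs (u1 x) <= C) ->
  (forall x, Y <= x -> Rabs (v x) <= D / x ^ 2 /\ Rabs (v1 x) <= D / x ^ 2) ->
  forall x, 0 < x -> u1 x * v x = u x * v1 x.
Proof.
  intros Su Sv HY HC HD Bu Bv x Hx.
  set (w := fun x => u1 x * v x - u x * v1 x).
  assert (K : forall x y, 0 < x -> 0 < y -> w x = w y).
  { apply constant_of_derivative_zero. intros y Hy.
    destruct (Su y Hy) as [D0 D1]. destruct (Sv y Hy) as [D2 D3].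
    unfold w. auto_derive.
    - repeat split; eexists; eassumption.
    - replace (Derive (fun v : R => u v) y) with (u1 y)
        by (symmetry; now apply is_derive_unique).
      replace (Derive (fun v : R => u1 v) y) with (whit_pot k c y * u y)
        by (symmetry; now apply is_derive_unique).
      replace (Derive (fun x : R => v x) y) with (v1 y)
        by (symmetry; now apply is_derive_unique).
      replace (Derive (fun v : R => v1 v) y) with (whit_pot k c y * v y)
        by (symmetry; now apply is_derive_unique).
      ring. }
  assert (Z : w x = 0).
  { destruct (Req_dec (w x) 0) as [|Hne]; [assumption|exfalso].
    assert (Hp : 0 < Rabs (w x)) by now apply Rabs_pos_lt.
    (* At this point [z * |w| >= 2 C D + 1], against the bound [z^2 * |w| <= 2 C D] with
       [z >= 1]. *)
    set (z := Rmax (Rmax X Y) ((2 * C * D + 1) / Rabs (w x))).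
    assert (z1 : X <= z) by (eapply Rle_trans; [apply Rmax_l|apply Rmax_l]).
    assert (z2 : Y <= z) by (eapply Rle_trans; [apply Rmax_r|apply Rmax_l]).
    assert (z3 : (2 * C * D + 1) / Rabs (w x) <= z) by apply Rmax_r.
    destruct (Bu z z1) as [Bu0 Bu1]. destruct (Bv z z2) as [Bv0 Bv1].
    assert (Bw : Rabs (w x) <= 2 * C * D / z ^ 2).
    { rewrite (K x z Hx ltac:(lra)). unfold w. unfold Rminus.
      eapply Rle_trans; [apply Rabs_triang|]. rewrite Rabs_Ropp, !Rabs_mult.
      replace (2 * C * D / z ^ 2) with (C * (D / z ^ 2) + C * (D / z ^ 2)) by (field; lra).
      apply Rplus_le_compat; apply Rmult_le_compat; auto using Rabs_pos. }
    apply Rmult_le_compat_r with (r := z ^ 2) in Bw; [|nra].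
    apply Rmult_le_compat_r with (r := Rabs (w x)) in z3; [|lra].
    unfold Rdiv in Bw, z3. rewrite Rmult_assoc, Rinv_l, Rmult_1_r in Bw by nra.
    rewrite Rmult_assoc, Rinv_l, Rmult_1_r in z3 by lra.
    assert (0 <= C * D) by (apply Rmult_le_pos; assumption).
    assert (0 <= (z - 1) * (z * Rabs (w x))) by (apply Rmult_le_pos; nra).
    nra. }
  unfold w in Z. lra.
Qed.

Lemma whit_asymp_nonzero (k : R) (v : R -> R) :
  whit_asymp k v 1 -> exists X, 0 < X /\ forall x, X <= x -> v x <> 0.
Proof.
  intros L. unfold whit_asymp in L. rewrite filterlim_locally in L.
  destruct (L (mkposreal 1 Rlt_0_1)) as [M HM]. exists (Rmax 1 (M + 1)).
  split; [apply Rlt_le_trans with 1; [lra|apply Rmax_l]|].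
  intros x Hx E. specialize (HM x).
  assert (M < x) by (apply Rlt_le_trans with (M + 1); [lra|];
    eapply Rle_trans; [apply Rmax_r|exact Hx]).
  specialize (HM H). change (Rabs (v x / whit_weight k x - 1) < 1) in HM.
  rewrite E in HM. unfold Rdiv in HM. rewrite Rmult_0_l in HM.
  apply Rabs_def2 in HM. lra.
Qed.

(** Beyond [Z], where [v] has no zero, [u / v] has derivative [0] by the vanishing Wronskian. Below
    [Z], [v] may vanish, so backward uniqueness is applied to [u - d v] instead. *)
Lemma whit_proportional (k c X C : R) (u u1 v v1 : R -> R) :
  whit_solution k c u u1 -> whit_solution k c v v1 -> whit_asymp k v 1 -> 0 <= C ->
  (forall x, X <= x -> Rabs (u x) <= C /\ Rabs (u1 x) <= C) ->
  exists d, forall x, 0 < x -> u x = d * v x.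
Proof.
  intros Su Sv Lv HC Bu.
  destruct (whit_solution_decay k k c 1 v v1 Sv Lv) as (Y & D & HY & HD & Bv).
  pose proof (whit_wronskian_zero k c X C Y D u u1 v v1 Su Sv HY HC HD Bu Bv) as W.
  destruct (whit_asymp_nonzero k v Lv) as (Z & HZ & Nv).
  set (d := u Z / v Z). exists d.
  assert (Sd : whit_solution k c (fun x => u x - d * v x) (fun x => u1 x - d * v1 x)).
  { intros x Hx. destruct (Su x Hx) as [D0 D1]. destruct (Sv x Hx) as [D2 D3].
    split.
    - apply (is_derive_minus (V := R_NormedModule) u); [exact D0|].
      now apply is_derive_scal.
    - replace (whit_pot k c x * (u x - d * v x))
        with (whit_pot k c x * u x - d * (whit_pot k c x * v x)) by ring.
      apply (is_derive_minus (V := R_NormedModule) u1); [exact D1|].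
      now apply is_derive_scal. }
  intros x Hx.
  destruct (Rle_lt_dec x Z) as [Hxz|Hxz].
  - apply Rminus_diag_uniq.
    apply (whit_solution_zero k c Z _ _ HZ Sd); [| |lra].
    + unfold d. field. apply Nv. lra.
    (* The vanishing Wronskian at [Z] turns equality of [u] and [d v] there into equality of their
       derivatives. *)
    + apply Rmult_eq_reg_r with (v Z); [|apply Nv; lra].
      rewrite Rmult_minus_distr_r, W by lra. unfold d. field. apply Nv. lra.
  - destruct (mean_value (fun y => u y / v y) (fun y => 0) Z x Hxz) as (xi & _ & E).
    + intros y Hy. destruct (Su y) as [D0 _]; [lra|]. destruct (Sv y) as [D2 _]; [lra|].
      assert (Ny : v y <> 0) by (apply Nv; lra).
      auto_derive.
      * repeat split; trivial; eexists; eassumption.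
      * replace (Derive (fun v : R => u v) y) with (u1 y)
          by (symmetry; now apply is_derive_unique).
        replace (Derive (fun x : R => v x) y) with (v1 y)
          by (symmetry; now apply is_derive_unique).
        assert (Wy := W y ltac:(lra)).
        transitivity ((u1 y * v y - u y * v1 y) / v y ^ 2); [field; exact Ny|].
        rewrite Wy, Rminus_diag. unfold Rdiv. ring.
    + fold d in E. replace (u x) with (u x / v x * v x) by (field; apply Nv; lra).
      f_equal. lra.
Qed.

(** Here [u] decays, hence [u = d v]; divided by the weight, this tends both to [0] and to [d]. *)
Lemma whit_asymp_zero (k c : R) (u u1 v v1 : R -> R) :
  whit_solution k c u u1 -> whit_solution k c v v1 ->
  whit_asymp k u 0 -> whit_asymp k v 1 -> forall x, 0 < x -> u x = 0.
Proof.
  intros Su Sv Lu Lv x Hx.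
  destruct (whit_solution_decay k k c 0 u u1 Su Lu) as (X & C & HX & HC & B).
  destruct (whit_proportional k c X C u u1 v v1 Su Sv Lv HC) as [d Hd].
  - intros y Hy. assert (C / y ^ 2 <= C).
    { rewrite <- (Rmult_1_r C) at 2. apply Rmult_le_compat_l; [exact HC|].
      rewrite <- Rinv_1. apply Rinv_le_contravar; nra. }
    destruct (B y Hy). lra.
  - assert (E : d = 0).
    { apply (filterlim_locally_unique (V := R_NormedModule)
        (F := Rbar_locally p_infty) (fun x => d * (v x / whit_weight k x))).
      - pose proof (filterlim_comp _ _ _ _ (fun y => d * y) _ _ _ Lv
          (filterlim_scal_r (V := R_NormedModule) d 1)) as F.
        change (scal d 1) with (d * 1) in F. now rewrite Rmult_1_r in F.
      - apply (filterlim_ext_loc (fun x => u x / whit_weight k x)); [|exact Lu].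
        exists 0. intros y Hy. rewrite Hd by exact Hy. unfold Rdiv. ring. }
    rewrite Hd, E by exact Hx. ring.
Qed.

(** By the mean value theorem on [[x, x + 1]], [g'] takes the value [g (x + 1) - g x] at points
    going to infinity, and these differences tend to [0]. *)
Lemma derivative_limit_zero (g g' : R -> R) (l m : R) :
  (forall x, 0 < x -> is_derive g x (g' x)) ->
  filterlim g (Rbar_locally p_infty) (locally l) ->
  filterlim g' (Rbar_locally p_infty) (locally m) -> m = 0.
Proof.
  intros D Hg Hg'. rewrite filterlim_locally in Hg, Hg'.
  destruct (Req_dec m 0) as [|Hm]; [assumption|exfalso].
  assert (He : 0 < Rabs m / 4) by (apply Rabs_pos_lt in Hm; lra).
  destruct (Hg (mkposreal _ He)) as [M HM]. destruct (Hg' (mkposreal _ He)) as [M' HM'].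
  set (x := Rmax 0 (Rmax M M') + 1).
  assert (Hx : 0 < x /\ M < x /\ M' < x).
  { unfold x. pose proof (Rmax_l 0 (Rmax M M')). pose proof (Rmax_r 0 (Rmax M M')).
    pose proof (Rmax_l M M'). pose proof (Rmax_r M M'). lra. }
  destruct (mean_value g g' x (x + 1)) as (xi & Hxi & E); [lra| |].
  { intros y Hy. apply D. lra. }
  assert (B1 := HM x ltac:(lra)). assert (B2 := HM (x + 1) ltac:(lra)).
  assert (B3 := HM' xi ltac:(lra)).
  change (Rabs (g x - l) < Rabs m / 4) in B1.
  change (Rabs (g (x + 1) - l) < Rabs m / 4) in B2.
  change (Rabs (g' xi - m) < Rabs m / 4) in B3.
  apply Rabs_def2 in B1. apply Rabs_def2 in B2. apply Rabs_def2 in B3.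
  destruct (Rcase_abs m) as [Hn|Hp].
  - rewrite (Rabs_left m Hn) in *. lra.
  - rewrite (Rabs_pos_eq m) in * by lra. lra.
Qed.

(** The combination [u = x w' - (x/2 - k) w] raises the index: it solves the equation with [k + 1]
    and inherits boundedness from the decay of [w], so [u = d v]. Only [d = -1] then has to be
    found. *)
Lemma whit_contiguous (k c : R) (v v1 w w1 : R -> R) :
  whit_solution k c w w1 -> whit_asymp k w 1 ->
  whit_solution (k + 1) c v v1 -> whit_asymp (k + 1) v 1 ->
  forall x, 0 < x -> x * w1 x = (x / 2 - k) * w x - v x.
Proof.
  intros Sw Lw Sv Lv.
  set (u := fun x => x * w1 x - (x / 2 - k) * w x).
  set (u1 := fun x => (1 + k - x / 2) * w1 x + (x / 4 - k + c / x - 1 / 2) * w x).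
  assert (Su : whit_solution (k + 1) c u u1).
  { intros x Hx. destruct (Sw x Hx) as [D0 D1].
    assert (R0 : Derive (fun v : R => w v) x = w1 x) by now apply is_derive_unique.
    assert (R1 : Derive (fun v : R => w1 v) x = whit_pot k c x * w x)
      by now apply is_derive_unique.
    split.
    - unfold u. auto_derive; [repeat split; eexists; eassumption|].
      rewrite R0, R1. unfold u1, whit_pot. field. lra.
    - unfold u1. auto_derive; [repeat split; try lra; eexists; eassumption|].
      rewrite R0, R1. unfold u, whit_pot. field. lra. }
  destruct (whit_solution_decay k k c 1 w w1 Sw Lw) as (X & C & HX & HC & B).
  (* The coefficients of [w1] and [w] in [u] and [u1] are at most [s x] with [s <= 2 + |k| + |c|],
     while [w] and [w1] are at most [C / x^2]. The two terms together give [2 s C]. *)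
  assert (Bu : forall x, X <= x ->
    Rabs (u x) <= (4 + 2 * Rabs k + 2 * Rabs c) * C /\
    Rabs (u1 x) <= (4 + 2 * Rabs k + 2 * Rabs c) * C).
  { intros x Hx. destruct (B x Hx) as [B0 B1].
    assert (Hr : C / x ^ 2 * x <= C).
    { replace (C / x ^ 2 * x) with (C * / x) by (field; lra).
      rewrite <- (Rmult_1_r C) at 2. apply Rmult_le_compat_l; [exact HC|].
      rewrite <- Rinv_1. apply Rinv_le_contravar; lra. }
    set (r := C / x ^ 2) in *.
    assert (Hk := Rle_abs k). assert (Hk' := Rle_abs (- k)). rewrite Rabs_Ropp in Hk'.
    assert (Hc : Rabs (c / x) <= Rabs c).
    { unfold Rdiv. rewrite Rabs_mult, (Rabs_pos_eq (/ x))
        by (left; apply Rinv_0_lt_compat; lra).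
      rewrite <- (Rmult_1_r (Rabs c)) at 2. apply Rmult_le_compat_l; [apply Rabs_pos|].
      rewrite <- Rinv_1. apply Rinv_le_contravar; lra. }
    apply Rabs_le_between in Hc.
    pose proof (Rabs_pos k). pose proof (Rabs_pos c).
    assert (Hr0 : 0 <= r) by (pose proof (Rabs_pos (w x)); lra).
    assert (T : forall p q s, Rabs p <= s * x -> Rabs q <= s * x ->
      Rabs (p * w1 x) + Rabs (q * w x) <= 2 * (s * C)).
    { intros p q s Hp Hq. rewrite !Rabs_mult.
      assert (Hs : 0 <= s).
      { pose proof (Rabs_pos p). apply Rmult_le_reg_r with x; lra. }
      assert (Rabs p * Rabs (w1 x) <= s * x * r)
        by (apply Rmult_le_compat; auto using Rabs_pos).
      assert (Rabs q * Rabs (w x) <= s * x * r)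
        by (apply Rmult_le_compat; auto using Rabs_pos).
      assert (s * (r * x) <= s * C) by (apply Rmult_le_compat_l; assumption).
      lra. }
    split.
    - unfold u. unfold Rminus at 1. eapply Rle_trans; [apply Rabs_triang|]. rewrite Rabs_Ropp.
      eapply Rle_trans; [apply (T _ _ (1 + Rabs k))|].
      + rewrite Rabs_pos_eq by lra. nra.
      + apply Rabs_le. nra.
      + nra.
    - unfold u1. eapply Rle_trans; [apply Rabs_triang|].
      eapply Rle_trans; [apply (T _ _ (2 + Rabs k + Rabs c))|].
      + apply Rabs_le. nra.
      + assert (0 <= (x - 1) * Rabs k) by (apply Rmult_le_pos; lra).
        assert (0 <= (x - 1) * Rabs c) by (apply Rmult_le_pos; lra).
        apply Rabs_le. lra.
      + nra. }
  assert (HC' : 0 <= (4 + 2 * Rabs k + 2 * Rabs c) * C).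
  { pose proof (Rabs_pos k). pose proof (Rabs_pos c). apply Rmult_le_pos; lra. }
  destruct (whit_proportional (k + 1) c X _ u u1 v v1 Su Sv Lv HC' Bu) as [d Hd].
  assert (Hw : forall x, 0 < x -> whit_weight (k + 1) x = x * whit_weight k x).
  { intros x Hx. unfold whit_weight.
    replace ((k + 1) * ln x) with (ln x + k * ln x) by ring.
    rewrite exp_plus, exp_ln by exact Hx. ring. }
  (* Since [x w1 = (x/2 - k) w + d v], the quotient of [w] by its weight has derivative [(1 - 2k/x)
     (w / weight_k) + d (v / weight_(k+1))], with limit [1 + d]. The quotient itself converges, so
     this limit is [0]. *)
  assert (E : 1 + d = 0).
  { apply (derivative_limit_zero (fun x => w x / whit_weight k x)
      (fun x => (1 - 2 * k * / x) * (w x / whit_weight k x)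
         + d * (v x / whit_weight (k + 1) x)) 1); [|exact Lw|].
    - intros x Hx. destruct (Sw x Hx) as [D0 _].
      assert (R0 : Derive (fun v : R => w v) x = w1 x) by now apply is_derive_unique.
      pose proof (exp_pos (k * ln x)). pose proof (exp_pos (- x / 2)).
      assert (E1 : d * v x = x * w1 x - (x / 2 - k) * w x) by (symmetry; now apply Hd).
      replace (d * (v x / whit_weight (k + 1) x))
        with ((x * w1 x - (x / 2 - k) * w x) / whit_weight (k + 1) x)
        by (rewrite <- E1; unfold Rdiv; ring).
      rewrite Hw by exact Hx. unfold whit_weight.
      auto_derive.
      + repeat split; try (eexists; eassumption); try lra. apply Rgt_not_eq. nra.
      + rewrite R0. unfold Rdiv. field. repeat split; lra.
    - assert (Li : filterlim (fun x => 1 - 2 * k * / x) (Rbar_locally p_infty) (locally 1)).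
      { assert (Hi : is_lim (fun x => 1 - 2 * k * / x) p_infty (1 - 2 * k * 0)).
        { apply (is_lim_minus (fun _ => 1) (fun x => 2 * k * / x) p_infty 1 (2 * k * 0));
            [apply is_lim_const| |reflexivity].
          apply (is_lim_scal_l (fun x => / x) (2 * k) p_infty 0).
          apply (is_lim_inv (fun x => x) p_infty p_infty); [apply is_lim_id|discriminate]. }
        rewrite Rmult_0_r, Rminus_0_r in Hi. exact Hi. }
      assert (Hs : is_lim (fun x => (1 - 2 * k * / x) * (w x / whit_weight k x)
         + d * (v x / whit_weight (k + 1) x)) p_infty (1 * 1 + d * 1)).
      { apply (is_lim_plus _ _ p_infty (1 * 1) (d * 1)); [| |reflexivity].
        - apply (is_lim_mult _ _ p_infty 1 1); [exact Li|exact Lw|exact I].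
        - apply (is_lim_scal_l (fun x => v x / whit_weight (k + 1) x) d p_infty 1). exact Lv. }
      rewrite !Rmult_1_r in Hs. exact Hs. }
  intros x Hx. specialize (Hd x Hx). unfold u in Hd.
  replace d with (-1) in Hd by lra. lra.
Qed.

(** * Passage to complex-valued functions *)

(** The equation for [B] is contiguity itself. The one for [A] follows by differentiating contiguity
    and eliminating [w'']; there [t] enters through [c], because [mu^2 = a^2 - t]. *)
Lemma whit_pair_system (a t : R) (v v1 w w1 : R -> R) :
  let c := a ^ 2 - t - 1 / 4 in
  whit_solution (a - 1 / 2) c w w1 -> whit_asymp (a - 1 / 2) w 1 ->
  whit_solution (a + 1 / 2) c v v1 -> whit_asymp (a + 1 / 2) v 1 ->
  let A := fun x => v x / sqrt x in
  let B := fun x => w x / sqrt x in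
  forall x, 0 < x ->
    is_derive A x (dA a t A B x) /\ is_derive B x (dB a A B x).
Proof.
  intros c Sw Lw Sv Lv A B x Hx.
  assert (R1 : forall x, 0 < x -> x * w1 x = (x / 2 - (a - 1 / 2)) * w x - v x).
  { replace (a + 1 / 2) with (a - 1 / 2 + 1) in Sv, Lv by lra.
    exact (whit_contiguous (a - 1 / 2) c v v1 w w1 Sw Lw Sv Lv). }
  destruct (Sw x Hx) as [Dw Dw1]. destruct (Sv x Hx) as [Dv _].
  assert (E0 : Derive (fun u : R => w u) x = w1 x) by now apply is_derive_unique.
  assert (E1 : Derive (fun u : R => w1 u) x = whit_pot (a - 1 / 2) c x * w x)
    by now apply is_derive_unique.
  assert (E2 : Derive (fun u : R => v u) x = v1 x) by now apply is_derive_unique.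
  (* Derivative of [v = (x/2 - (a - 1/2)) w - x w1]. *)
  assert (Ev : v1 x = w x / 2 + (x / 2 - (a - 1 / 2)) * w1 x - w1 x
                      - x * (whit_pot (a - 1 / 2) c x * w x)).
  { rewrite <- E2. apply is_derive_unique.
    apply (is_derive_ext_loc (fun x => (x / 2 - (a - 1 / 2)) * w x - x * w1 x)).
    - generalize (locally_pos x Hx). apply filter_imp. intros u Hu.
      rewrite R1 by exact Hu. apply Rminus_diag_uniq. ring.
    - auto_derive; [repeat split; eexists; eassumption|]. rewrite E0, E1. field. }
  assert (Ew : w1 x = ((x / 2 - (a - 1 / 2)) * w x - v x) / x)
    by (rewrite <- R1 by exact Hx; field; lra).
  assert (Hs : 0 < sqrt x) by now apply sqrt_lt_R0.
  assert (Hs2 : sqrt x * sqrt x = x) by (apply sqrt_sqrt; lra).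
  split.
  - unfold A at 1. auto_derive.
    + repeat split; try lra; eexists; eassumption.
    + rewrite E2, Ev, Ew. unfold dA, A, B, whit_pot, c.
      set (s := sqrt x) in *. rewrite <- Hs2. field. lra.
  - unfold B at 1. auto_derive.
    + repeat split; try lra; eexists; eassumption.
    + rewrite E0, Ew. unfold dB, A, B.
      set (s := sqrt x) in *. rewrite <- Hs2. field. lra.
Qed.

Lemma filterdiff_fst_C (f : R -> C) (F : (R -> Prop) -> Prop) {FF : Filter F} (l : C) :
  @filterdiff R_AbsRing R_NormedModule C_R_NormedModule f F
    (fun y : R => @scal R_Ring C_R_ModuleSpace y l) ->
  @filterdiff R_AbsRing R_NormedModule R_NormedModule (fun u => fst (f u)) F
    (fun y : R => y * fst l).
Proof.
  intros H.
  apply (filterdiff_comp (U := R_NormedModule) (V := C_R_NormedModule) (W := R_NormedModule)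
    f (fun z : C => fst z) _ (fun z : C => fst z) H).
  apply (filterdiff_linear (U := C_R_NormedModule) (V := R_NormedModule)).
  apply (is_linear_fst (U := R_NormedModule) (V := R_NormedModule)).
Qed.

Lemma filterdiff_snd_C (f : R -> C) (F : (R -> Prop) -> Prop) {FF : Filter F} (l : C) :
  @filterdiff R_AbsRing R_NormedModule C_R_NormedModule f F
    (fun y : R => @scal R_Ring C_R_ModuleSpace y l) ->
  @filterdiff R_AbsRing R_NormedModule R_NormedModule (fun u => snd (f u)) F
    (fun y : R => y * snd l).
Proof.
  intros H.
  apply (filterdiff_comp (U := R_NormedModule) (V := C_R_NormedModule) (W := R_NormedModule)
    f (fun z : C => snd z) _ (fun z : C => snd z) H).
  apply (filterdiff_linear (U := C_R_NormedModule) (V := R_NormedModule)).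
  apply (is_linear_snd (U := R_NormedModule) (V := R_NormedModule)).
Qed.

Lemma is_derive_C_components (f : R -> C) (x : R) (l : C) :
  @is_derive R_AbsRing C_R_NormedModule f x l ->
  is_derive (fun u => fst (f u)) x (fst l) /\ is_derive (fun u => snd (f u)) x (snd l).
Proof.
  intros H. split; [exact (filterdiff_fst_C f _ l H) | exact (filterdiff_snd_C f _ l H)].
Qed.

Lemma is_derive_C_pair (f g : R -> R) (x l m : R) :
  is_derive f x l -> is_derive g x m ->
  @is_derive R_AbsRing C_R_NormedModule (fun u => (f u, g u)) x (l, m).
Proof.
  intros Hf Hg.
  pose proof (is_derive_plus (V := C_R_NormedModule) _ _ _ _ _
    (is_derive_scal_l (V := C_R_NormedModule) f x l (RtoC 1) Hf)
    (is_derive_scal_l (V := C_R_NormedModule) g x m Ci Hg)) as H.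
  assert (E : forall r s : R,
    @plus C_R_NormedModule (@scal R_Ring C_R_ModuleSpace r (RtoC 1))
      (@scal R_Ring C_R_ModuleSpace s Ci) = (r, s)).
  { intros r s. unfold plus, scal, RtoC, Ci; simpl. unfold prod_plus, prod_scal; simpl.
    unfold scal, plus; simpl. unfold mult; simpl. f_equal; ring. }
  rewrite <- (E l m). revert H. apply is_derive_ext. intros u. apply E.
Qed.

Lemma Rcpow_RtoC (x k : R) : Rcpow x (RtoC k) = RtoC (exp (k * ln x)).
Proof.
  unfold Rcpow, Cexp, RtoC, Cmult; simpl.
  replace (k * 0 + 0 * ln x) with 0 by ring.
  rewrite cos_0, sin_0. f_equal; [|ring]. rewrite Rmult_1_r. f_equal. ring.
Qed.

Lemma Cdiv_RtoC (z : C) (r : R) : r <> 0 -> (z / RtoC r)%C = (fst z / r, snd z / r).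
Proof.
  intros Hr. destruct z as [x y]. unfold Cdiv, Cmult, Cinv, RtoC; simpl.
  f_equal; field; exact Hr.
Qed.

Lemma Cmult_RtoC_l (z : C) (r : R) : (RtoC r * z)%C = (r * fst z, r * snd z).
Proof. destruct z as [x y]. unfold Cmult, RtoC; simpl. f_equal; ring. Qed.

Lemma filterlim_C_components (f : R -> C) (F : (R -> Prop) -> Prop) {FF : Filter F} (l : C) :
  filterlim (f : R -> C_R_NormedModule) F (locally (T := C_R_NormedModule) l) <->
  filterlim (fun u => fst (f u)) F (locally (fst l)) /\
  filterlim (fun u => snd (f u)) F (locally (snd l)).
Proof.
  rewrite !filterlim_locally. split.
  - intros H. split; intros eps; generalize (H eps); apply filter_imp; intros u [H1 H2]; assumption.
  - intros [H1 H2] eps. generalize (filter_and _ _ (H1 eps) (H2 eps)). apply filter_imp.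
    intros u [A B]. split; assumption.
Qed.

(** The equation involves [mu] only through [mu^2], which is real even when [mu] is imaginary. With
    real coefficients, real and imaginary parts solve it separately. *)
Lemma is_whittaker_components (k c : R) (mu : C) (W : R -> C) :
  (mu * mu)%C = RtoC (c + 1 / 4) -> is_whittaker (RtoC k) mu W ->
  (exists u1, whit_solution k c (fun x => fst (W x)) u1) /\
  (exists u1, whit_solution k c (fun x => snd (W x)) u1) /\
  whit_asymp k (fun x => fst (W x)) 1 /\ whit_asymp k (fun x => snd (W x)) 0.
Proof.
  intros Hmu [[W1 HW] L].
  assert (P : forall x, 0 < x -> (RtoC (1 / 4) - RtoC k / RtoC x
         + (mu * mu - RtoC (1 / 4)) / RtoC (x ^ 2))%C = RtoC (whit_pot k c x)).
  { intros x Hx. rewrite Hmu, <- RtoC_minus, <- !RtoC_div, <- RtoC_minus, <- RtoC_plus by nra.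
    f_equal. unfold whit_pot. field. lra. }
  assert (E : forall x, 0 < x ->
    (W x / (Rcpow x (RtoC k) * RtoC (exp (- x / 2))))%C
    = (fst (W x) / whit_weight k x, snd (W x) / whit_weight k x)).
  { intros x Hx. rewrite Rcpow_RtoC, <- RtoC_mult. apply Cdiv_RtoC.
    apply Rgt_not_eq, whit_weight_pos. }
  apply (filterlim_ext_loc (F := Rbar_locally p_infty) _
    (fun x => (fst (W x) / whit_weight k x, snd (W x) / whit_weight k x) : C_R_NormedModule)) in L;
    [|exists 0; exact E].
  apply filterlim_C_components in L; [|apply filter_filter].
  repeat split; try apply L.
  - exists (fun x => fst (W1 x)). intros x Hx. destruct (HW x Hx) as [D0 D1].
    rewrite P, Cmult_RtoC_l in D1 by exact Hx.
    split; [apply (is_derive_C_components _ _ _ D0)|apply (is_derive_C_components _ _ _ D1)].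
  - exists (fun x => snd (W1 x)). intros x Hx. destruct (HW x Hx) as [D0 D1].
    rewrite P, Cmult_RtoC_l in D1 by exact Hx.
    split; [apply (is_derive_C_components _ _ _ D0)|apply (is_derive_C_components _ _ _ D1)].
Qed.

(* The imaginary part of [W] is a solution that is negligible against the recessive one. *)
Lemma is_whittaker_real (k c : R) (mu : C) (W : R -> C) :
  (mu * mu)%C = RtoC (c + 1 / 4) -> is_whittaker (RtoC k) mu W ->
  exists u u1, whit_solution k c u u1 /\ whit_asymp k u 1 /\
    forall x, 0 < x -> W x = RtoC (u x).
Proof.
  intros Hmu HW.
  destruct (is_whittaker_components k c mu W Hmu HW) as ([r1 Sr] & [i1 Si] & Lr & Li).
  exists (fun x => fst (W x)), r1. repeat split; try assumption; try now apply Sr.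
  intros x Hx. pose proof (whit_asymp_zero k c _ _ _ _ Si Sr Li Lr x Hx) as E.
  cbv beta in E. destruct (W x) as [wr wi]. simpl in E |- *. now rewrite E.
Qed.

(** * One-sided derivatives on [[tau, oo)] and extension across [tau] *)

Definition one_sided_derive (tau : R) (f : R -> R) (x l : R) : Prop :=
  forall eps : posreal, exists d : posreal, forall u, tau <= u -> Rabs (u - x) < d ->
    Rabs (f u - f x - (u - x) * l) <= eps * Rabs (u - x).

Lemma one_sided_derive_of_filterdiff (tau : R) (f : R -> R) (x l : R) :
  @filterdiff R_AbsRing R_NormedModule R_NormedModule f (within (Rle tau) (locally x))
    (fun y => y * l) -> one_sided_derive tau f x l.
Proof.
  intros [_ H] eps.
  assert (Hl : is_filter_lim (within (Rle tau) (locally x)) x).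
  { intros P HP. unfold within. revert HP. apply filter_imp. auto. }
  destruct (H x Hl eps) as [d Hd]. exists d. intros u Hu Hx. exact (Hd u Hx Hu).
Qed.

Lemma is_derive_of_eps (f : R -> R) (x l : R) :
  (forall eps : posreal, locally x (fun u =>
     Rabs (f u - f x - (u - x) * l) <= eps * Rabs (u - x))) -> is_derive f x l.
Proof.
  intros H. split; [apply is_linear_scal_l|].
  intros y Hy. apply (is_filter_lim_locally_unique (V := R_NormedModule)) in Hy.
  subst y. exact H.
Qed.

(** Points [x + s] with [s > 0] always belong to [[tau, oo)], so right increments determine the
    slope even at [tau]. *)
Lemma one_sided_derive_unique (tau : R) (f : R -> R) (x l m : R) : tau <= x ->
  one_sided_derive tau f x l -> one_sided_derive tau f x m -> l = m.
Proof.
  intros Hx Hl Hm. destruct (Req_dec l m) as [|Hne]; [assumption|exfalso].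
  assert (He : 0 < Rabs (l - m) / 4) by (pose proof (Rabs_pos_lt (l - m)); lra).
  destruct (Hl (mkposreal _ He)) as [d Hd]. destruct (Hm (mkposreal _ He)) as [d' Hd'].
  set (s := Rmin d d' / 2).
  assert (Hs : 0 < s /\ s < d /\ s < d').
  { unfold s. pose proof (Rmin_l d d'). pose proof (Rmin_r d d').
    pose proof (Rmin_pos d d' (cond_pos d) (cond_pos d')). lra. }
  assert (Ha : Rabs (x + s - x) = s) by (rewrite Rabs_pos_eq; lra).
  specialize (Hd (x + s) ltac:(lra) ltac:(lra)). specialize (Hd' (x + s) ltac:(lra) ltac:(lra)).
  rewrite Ha in Hd, Hd'. simpl in Hd, Hd'.
  assert (Rabs ((l - m) * s) <= Rabs (l - m) / 2 * s).
  { replace ((l - m) * s) with ((f (x + s) - f x - (x + s - x) * m)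
      - (f (x + s) - f x - (x + s - x) * l)) by ring.
    unfold Rminus at 1. eapply Rle_trans; [apply Rabs_triang|]. rewrite Rabs_Ropp. lra. }
  rewrite Rabs_mult, (Rabs_pos_eq s) in H by lra. nra.
Qed.

Lemma is_derive_glue (tau : R) (f g : R -> R) (l : R) :
  f tau = g tau -> one_sided_derive tau f tau l -> is_derive g tau l ->
  is_derive (fun y => if Rle_dec tau y then f y else g y) tau l.
Proof.
  intros E Hf [_ Hg]. apply is_derive_of_eps. intros eps.
  destruct (Hf eps) as [d Hd].
  assert (Hl : is_filter_lim (locally tau) tau) by (intros P HP; exact HP).
  generalize (filter_and _ _ (locally_ball tau d) (Hg tau Hl eps)). apply filter_imp.
  intros u [Hu Hgu].
  destruct (Rle_dec tau tau) as [_|n]; [|lra].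
  destruct (Rle_dec tau u) as [Htu|_].
  - now apply Hd.
  - rewrite E. exact Hgu.
Qed.

Lemma one_sided_derive_interior (tau : R) (f : R -> R) (x l : R) :
  tau < x -> one_sided_derive tau f x l -> is_derive f x l.
Proof.
  intros Hx H. apply is_derive_of_eps. intros eps. destruct (H eps) as [d Hd].
  generalize (filter_and _ _ (locally_ball x d) (open_gt tau x Hx)). apply filter_imp.
  intros u [Hu Htu]. apply Hd; [now left|exact Hu].
Qed.

(** To the left of [tau] the function is continued by its second order Taylor polynomial at [tau],
    so that two derivatives match there and the second one is constant beyond. *)
Lemma one_sided_C2_extension (tau : R) (f f1 f2 : R -> R) :
  (forall x, tau <= x -> one_sided_derive tau f x (f1 x)) ->
  (forall x, tau <= x -> one_sided_derive tau f1 x (f2 x)) ->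
  (forall x, tau <= x -> filterlim f2 (within (Rle tau) (locally x)) (locally (f2 x))) ->
  exists h h1 h2 : R -> R,
    (forall x, is_derive h x (h1 x)) /\ (forall x, is_derive h1 x (h2 x)) /\
    (forall x, continuous h2 x) /\ (forall x, tau <= x -> h x = f x).
Proof.
  intros D0 D1 C2.
  assert (X : forall f g f' g' : R -> R, f tau = g tau -> f' tau = g' tau ->
    (forall x, tau <= x -> one_sided_derive tau f x (f' x)) ->
    (forall x, is_derive g x (g' x)) ->
    forall x, is_derive (fun y => if Rle_dec tau y then f y else g y) x
      (if Rle_dec tau x then f' x else g' x)).
  { clear. intros f g f' g' E E' Hf Hg x.
    destruct (Rtotal_order x tau) as [Hx|[->|Hx]].
    - destruct (Rle_dec tau x) as [n|_]; [lra|].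
      apply (is_derive_ext_loc g); [|apply Hg].
      generalize (open_lt tau x Hx). apply filter_imp. intros u Hu.
      destruct (Rle_dec tau u); [lra|reflexivity].
    - destruct (Rle_dec tau tau) as [_|n]; [|lra]. apply is_derive_glue; auto.
      + apply Hf; lra.
      + rewrite E'. apply Hg.
    - destruct (Rle_dec tau x) as [_|n]; [|lra].
      apply (is_derive_ext_loc f); [|apply (one_sided_derive_interior tau); auto with real].
      generalize (open_gt tau x Hx). apply filter_imp. intros u Hu.
      destruct (Rle_dec tau u); [reflexivity|lra]. }
  set (g := fun y => f tau + (y - tau) * f1 tau + (y - tau) ^ 2 / 2 * f2 tau).
  set (g1 := fun y => f1 tau + (y - tau) * f2 tau).
  exists (fun y => if Rle_dec tau y then f y else g y),
    (fun y => if Rle_dec tau y then f1 y else g1 y),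
    (fun y => if Rle_dec tau y then f2 y else f2 tau).
  split; [|split; [|split]].
  - apply (X f g f1 g1); auto.
    + unfold g. rewrite Rminus_diag. field.
    + unfold g1. rewrite Rminus_diag. ring.
    + intros y. unfold g, g1. auto_derive; trivial. field.
  - apply (X f1 g1 f2 (fun _ => f2 tau)); auto.
    + unfold g1. rewrite Rminus_diag. ring.
    + intros y. unfold g1. auto_derive; trivial. ring.
  - intros x. unfold continuous. apply filterlim_locally. intros eps.
    destruct (Rle_dec tau x) as [Hx|Hx].
    + specialize (C2 x Hx). rewrite filterlim_locally in C2.
      specialize (C2 eps). unfold within in C2.
      destruct Hx as [Hx|<-].
      * generalize (filter_and _ _ C2 (open_gt tau x Hx)). apply filter_imp.
        intros u [Hu Htu]. destruct (Rle_dec tau u); auto. lra.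
      * revert C2. apply filter_imp. intros u Hu. destruct (Rle_dec tau u); auto.
        apply ball_center.
    + generalize (open_lt tau x (Rnot_le_lt _ _ Hx)). apply filter_imp.
      intros u Hu. destruct (Rle_dec tau u); [lra|]. apply ball_center.
  - intros x Hx. destruct (Rle_dec tau x); [reflexivity|lra].
Qed.

Lemma is_derive_from_components (tau : R) (f : R -> C) (x : R) (l : C) :
  is_derive_from tau f x l ->
  one_sided_derive tau (fun u => fst (f u)) x (fst l) /\
  one_sided_derive tau (fun u => snd (f u)) x (snd l).
Proof.
  intros H. split; apply one_sided_derive_of_filterdiff.
  - exact (filterdiff_fst_C f _ l H).
  - exact (filterdiff_snd_C f _ l H).
Qed.

Lemma is_derive_from_unique (tau : R) (f : R -> C) (x : R) (l m : C) :
  tau <= x -> is_derive_from tau f x l -> is_derive_from tau f x m -> l = m.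
Proof.
  intros Hx Hl Hm.
  destruct (is_derive_from_components _ _ _ _ Hl) as [L1 L2].
  destruct (is_derive_from_components _ _ _ _ Hm) as [M1 M2].
  apply injective_projections; eapply one_sided_derive_unique; eassumption.
Qed.

Lemma Derive_from_correct (tau : R) (f : R -> C) (x : R) (l : C) :
  tau <= x -> is_derive_from tau f x l -> Derive_from tau f x = l.
Proof.
  intros Hx Hl. apply (iota_unique (V := C_R_CompleteNormedModule)).
  - intros m Hm. now apply (is_derive_from_unique tau f x).
  - exact Hl.
Qed.

Lemma is_derive_from_two_sided (tau : R) (f : R -> C) (g h : R -> R) (x l m : R) :
  tau <= x -> (forall y, tau <= y -> f y = (g y, h y)) ->
  is_derive g x l -> is_derive h x m -> is_derive_from tau f x (l, m).
Proof.
  intros Hx E Dg Dh. destruct (is_derive_C_pair g h x l m Dg Dh) as [L D].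
  split; [exact L|]. intros y Hy.
  (* The filter is proper because [x] itself lies in [[tau, oo)]; hence its limit point is unique
     and must be [x]. *)
  assert (PF : ProperFilter' (within (Rle tau) (locally x))).
  { constructor; [|apply within_filter, locally_filter].
    intros H. exact (locally_singleton _ _ H Hx). }
  assert (y = x) as ->.
  { apply (is_filter_lim_unique (V := R_NormedModule) (F := within (Rle tau) (locally x)));
      [exact Hy|].
    intros P HP. unfold within. revert HP. apply filter_imp. auto. }
  intros eps. generalize (D x (fun P HP => HP) eps). unfold within. apply filter_imp.
  intros u Hu Htu. rewrite !E by assumption. exact Hu.
Qed.

(** * Reduction of the two operators to real components *)

Lemma is_RInt_gen_eventually_zero (g : R -> C) (gr gi : R -> R) (tau M lr li : R) :
  tau <= M -> (forall y, tau <= y -> g y = (gr y, gi y)) ->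
  (forall y, M <= y -> gr y = 0 /\ gi y = 0) ->
  is_RInt gr tau M lr -> is_RInt gi tau M li ->
  @is_RInt_gen C_R_NormedModule g (at_point tau) (Rbar_locally p_infty) (lr, li).
Proof.
  intros HM E Z Ir Ii P HP.
  apply Filter_prod with (Q := fun u => u = tau) (R := fun v => M < v).
  - reflexivity.
  - now exists M.
  - intros u v -> Hv. exists (lr, li). split; [|now apply locally_singleton]. simpl.
    assert (X : forall k l, (forall y, M <= y -> k y = 0) -> is_RInt k tau M l ->
      is_RInt k tau v l).
    { intros k l Zk Ik. replace l with (l + (v - M) * 0) by ring.
      apply (is_RInt_Chasles (V := R_NormedModule) k tau M v l ((v - M) * 0)); [exact Ik|].
      apply (is_RInt_ext (fun _ => 0)).
      - intros y Hy. rewrite Rmin_left in Hy by lra. symmetry. apply Zk. lra.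
      - apply (is_RInt_const (V := R_NormedModule)). }
    apply (is_RInt_ext (V := C_R_NormedModule) (fun y => (gr y, gi y))).
    + intros y Hy. rewrite Rmin_left in Hy by lra. symmetry. apply E. lra.
    + apply (is_RInt_fct_extend_pair (U := R_NormedModule) (V := R_NormedModule)
        (fun y => (gr y, gi y))); apply X; try assumption; intros y Hy; now apply Z.
Qed.

Lemma derivative_eventually_zero (h h1 : R -> R) (X : R) :
  (forall x, is_derive h x (h1 x)) -> (forall x, X < x -> h x = 0) ->
  forall x, X < x -> h1 x = 0.
Proof.
  intros D Z x Hx. rewrite <- (is_derive_unique _ _ _ (D x)).
  apply is_derive_unique, (is_derive_ext_loc (fun _ => 0)); [|exact (is_derive_const (V := R_NormedModule) 0 x)].
  generalize (open_gt X x Hx). apply filter_imp. intros u Hu. symmetry. now apply Z.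
Qed.

Lemma sturm_liouville_components (tau : R) (q : R -> R) (f : R -> C)
    (g g1 g2 h h1 h2 : R -> R) :
  (forall x, tau <= x -> f x = (g x, h x)) ->
  (forall x, tau <= x -> is_derive g x (g1 x)) ->
  (forall x, tau <= x -> is_derive h x (h1 x)) ->
  (forall x, tau <= x -> is_derive g1 x (g2 x)) ->
  (forall x, tau <= x -> is_derive h1 x (h2 x)) ->
  forall x, tau <= x ->
    sturm_liouville tau (fun x => RtoC (x * (x - tau))) (fun x => RtoC (q x)) f x
    = (sturm_liouville_real q tau g g1 g2 x, sturm_liouville_real q tau h h1 h2 x).
Proof.
  intros E Dg Dh Dg1 Dh1 x Hx. unfold sturm_liouville.
  assert (D1 : forall y, tau <= y -> Derive_from tau f y = (g1 y, h1 y)).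
  { intros y Hy. apply Derive_from_correct; [exact Hy|].
    apply (is_derive_from_two_sided tau f g h); auto. }
  assert (P : forall k1 k2 : R -> R, is_derive k1 x (k2 x) ->
    is_derive (fun y => y * (y - tau) * k1 y) x ((2 * x - tau) * k1 x + x * (x - tau) * k2 x)).
  { intros k1 k2 D. auto_derive; [now exists (k2 x)|].
    replace (Derive (fun v : R => k1 v) x) with (k2 x) by (symmetry; now apply is_derive_unique).
    ring. }
  rewrite (Derive_from_correct tau _ x ((2 * x - tau) * g1 x + x * (x - tau) * g2 x,
      (2 * x - tau) * h1 x + x * (x - tau) * h2 x) Hx).
  - rewrite Cmult_RtoC_l, E by exact Hx. reflexivity.
  - apply (is_derive_from_two_sided tau _ (fun y => y * (y - tau) * g1 y)
      (fun y => y * (y - tau) * h1 y)); [exact Hx| | |].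
    + intros y Hy. rewrite D1, Cmult_RtoC_l by exact Hy. reflexivity.
    + apply P; auto.
    + apply P; auto.
Qed.

(** * The Whittaker kernel as a constant multiple of [kern] *)

Lemma series_parameters_real (z z' : C) :
  principal_series z z' \/ complementary_series z z' ->
  exists a t : R, (z + z')%C = RtoC (2 * a) /\ (z * z')%C = RtoC t.
Proof.
  intros [[_ ->]|(x & x' & _ & -> & -> & _)].
  - exists (fst z), (fst z ^ 2 + snd z ^ 2). destruct z as [x y].
    unfold Cplus, Cmult, Cconj, RtoC; simpl. split; f_equal; ring.
  - exists ((x + x') / 2), (x * x'). rewrite <- RtoC_plus, <- RtoC_mult.
    split; f_equal; field.
Qed.

Section ComplexKernel.
Variables (z z' : C) (a t : R) (W : C -> C -> R -> C) (v w : R -> R).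
Hypothesis Hv : forall x, 0 < x -> W (kappa_of z z') (mu_of z z') x = RtoC (v x).
Hypothesis Hw : forall x, 0 < x -> W (kappa_of z z' - RtoC 1)%C (mu_of z z') x = RtoC (w x).

Let A (x : R) : R := v x / sqrt x.
Let B (x : R) : R := w x / sqrt x.
Hypothesis DA : forall x, 0 < x -> is_derive A x (dA a t A B x).
Hypothesis DB : forall x, 0 < x -> is_derive B x (dB a A B x).

Lemma whittaker_kernel_kern (x y : R) : 0 < x -> 0 < y ->
  whittaker_kernel W z z' x y
  = (/ (Cgamma z * Cgamma z') * RtoC (kern a t A B x y))%C.
Proof.
  assert (Off : forall x y, 0 < x -> 0 < y -> x <> y ->
    whittaker_kernel_offdiag W z z' x y
    = (/ (Cgamma z * Cgamma z') * RtoC (kern a t A B x y))%C).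
  { clear x y. intros x y Hx Hy Hxy. unfold whittaker_kernel_offdiag.
    rewrite !Hv, !Hw by assumption.
    rewrite <- !RtoC_mult, <- RtoC_minus, <- RtoC_div by lra.
    unfold Cdiv. rewrite (Cmult_comm (RtoC (/ sqrt (x * y)))), <- Cmult_assoc, <- RtoC_mult.
    do 2 f_equal. apply Rmult_eq_reg_r with (x - y); [|lra].
    rewrite (kern_offdiag a t A B DA DB x y Hx Hy). unfold A, B.
    rewrite sqrt_mult by lra.
    assert (0 < sqrt x) by now apply sqrt_lt_R0.
    assert (0 < sqrt y) by now apply sqrt_lt_R0.
    field. repeat split; lra. }
  intros Hx Hy. unfold whittaker_kernel.
  destruct (Req_EM_T x y) as [<-|Hxy]; [|now apply Off].
  set (c := (/ (Cgamma z * Cgamma z'))%C).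
  assert (PF : ProperFilter' (locally' x))
    by apply (Proper_StrongProper _ (Rbar_locally'_filter x)).
  apply (iota_filterlim_locally (V := C_R_CompleteNormedModule) (F := locally' x)).
  apply (filterlim_ext_loc (F := locally' x)
    (fun s => (c * RtoC (kern a t A B x s))%C : C_R_NormedModule)).
  - unfold locally', within. generalize (locally_pos x Hx). apply filter_imp.
    intros s Hs Hne. symmetry. apply Off; auto.
  (* [kern] is continuous at the diagonal point itself, so the limit over the punctured
     neighbourhood follows from the limit over the full one. *)
  - intros P HP. unfold filtermap, locally', within.
    cut (locally x (fun s => P (c * RtoC (kern a t A B x s))%C)).
    { apply filter_imp. auto. }
    revert P HP.
    change (filterlim (fun s => (c * RtoC (kern a t A B x s))%C : C_R_NormedModule)
      (locally x) (locally (T := C_R_NormedModule) (c * RtoC (kern a t A B x x))%C)).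
    assert (Ck : continuous (fun s => kern a t A B x s) x).
    { apply continuity_2d_pt_section_r.
      apply (kern_form_continuous a t A B DA DB 0 (dA a t A B) (dB a A B)); auto.
      - intros u Hu. apply (continuous_of_is_derive (dA a t A B) (ddA a t A B)).
        now apply is_derive_dA.
      - intros u Hu. apply (continuous_of_is_derive (dB a A B) (ddB a t A B)).
        now apply is_derive_dB. }
    apply filterlim_C_components; [apply locally_filter|].
    rewrite Cmult_comm, Cmult_RtoC_l. simpl.
    split.
    + apply (filterlim_ext (fun s => kern a t A B x s * fst c)).
      { intros s. simpl. ring. }
      apply (continuous_Rmult _ (fun _ => fst c)); [exact Ck|apply continuous_const].
    + apply (filterlim_ext (fun s => kern a t A B x s * snd c)).
      { intros s. simpl. ring. }
      apply (continuous_Rmult _ (fun _ => snd c)); [exact Ck|apply continuous_const].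
Qed.
End ComplexKernel.

Theorem proposition6p2
  (z z' : C)
  (Hzz' : principal_series z z' \/ complementary_series z z')
  (W : C -> C -> R -> C)
  (HW : is_whittaker (kappa_of z z') (mu_of z z')
          (W (kappa_of z z') (mu_of z z')))
  (HW1 : is_whittaker (kappa_of z z' - RtoC 1)%C (mu_of z z')
           (W (kappa_of z z' - RtoC 1)%C (mu_of z z')))
  (tau : R) (Htau : 0 < tau) :
  let a : C := ((z + z') / RtoC 2)%C in
  let t : C := (z * z')%C in
  let p : R -> C := fun x => RtoC (x * (x - tau)) in
  let q : R -> C := fun x =>
    (- ((((a - RtoC (x / 2)) * (a - RtoC (x / 2)) - t) * RtoC (x - tau))
        / RtoC x))%C in
  commutes_with_sturm_liouville tau (whittaker_kernel W z z') p q.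
Proof.
  intros aC tC p q.
  destruct (series_parameters_real z z' Hzz') as (a & t & Ea & Et).
  assert (Hk : kappa_of z z' = RtoC (a + 1 / 2)).
  { unfold kappa_of. rewrite Ea, <- RtoC_plus, <- RtoC_div by lra. f_equal. field. }
  assert (Hk1 : (kappa_of z z' - RtoC 1)%C = RtoC (a - 1 / 2)).
  { rewrite Hk, <- RtoC_minus. f_equal. field. }
  (* [mu^2 = ((z + z')^2 - 4 z z') / 4 = a^2 - t], kept in the form [c + 1/4]. *)
  assert (Hmu : (mu_of z z' * mu_of z z')%C = RtoC (a ^ 2 - t - 1 / 4 + 1 / 4)).
  { replace (a ^ 2 - t - 1 / 4 + 1 / 4) with (2 * a * (2 * a) / 4 - t) by field.
    rewrite RtoC_minus, RtoC_div, RtoC_mult, <- Ea, <- Et by lra.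
    replace (RtoC 4) with (RtoC 2 * RtoC 2)%C by (rewrite <- RtoC_mult; f_equal; ring).
    unfold mu_of. field. }
  rewrite Hk1 in HW1. rewrite Hk in HW.
  destruct (is_whittaker_real _ _ _ _ Hmu HW) as (v & v1 & Sv & Lv & Ev).
  destruct (is_whittaker_real _ _ _ _ Hmu HW1) as (w & w1 & Sw & Lw & Ew).
  rewrite <- Hk in Ev. rewrite <- Hk1 in Ew.
  set (A := fun x => v x / sqrt x). set (B := fun x => w x / sqrt x).
  assert (DA : forall x, 0 < x -> is_derive A x (dA a t A B x))
    by (intros x Hx; exact (proj1 (whit_pair_system a t v v1 w w1 Sw Lw Sv Lv x Hx))).
  assert (DB : forall x, 0 < x -> is_derive B x (dB a A B x))
    by (intros x Hx; exact (proj2 (whit_pair_system a t v v1 w w1 Sw Lw Sv Lv x Hx))).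
  set (qr := fun x => - ((a - x / 2) ^ 2 - t) * (x - tau) / x).
  assert (Eq : forall x, 0 < x -> q x = RtoC (qr x)).
  { intros x Hx. unfold q, aC, tC, qr. rewrite Ea, Et, <- RtoC_div by lra.
    rewrite <- !RtoC_minus, <- !RtoC_mult, <- RtoC_minus, <- RtoC_mult, <- RtoC_div, <- RtoC_opp
      by lra.
    f_equal. field. lra. }
  set (c := (/ (Cgamma z * Cgamma z'))%C).
  set (k := kern a t A B). set (k1 := kern1 a t A B). set (k2 := kern2 a t A B).
  assert (EK : forall x y, 0 < x -> 0 < y -> whittaker_kernel W z z' x y = (c * RtoC (k x y))%C)
    by (intros x y Hx Hy; exact (whittaker_kernel_kern z z' a t W v w Ev Ew DA DB x y Hx Hy)).
  assert (Ck : forall x y, 0 < x -> 0 < y -> continuity_2d_pt k x y).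
  { intros x y Hx Hy.
    apply (kern_form_continuous a t A B DA DB 0 (dA a t A B) (dB a A B)); auto;
      intros u Hu.
    - now apply (continuous_of_is_derive _ (ddA a t A B)), is_derive_dA.
    - now apply (continuous_of_is_derive _ (ddB a t A B)), is_derive_dB. }
  assert (Ck1 : forall x y, 0 < x -> 0 < y -> continuity_2d_pt k1 x y).
  { intros x y Hx Hy.
    apply (kern_form_continuous a t A B DA DB 1 (ddA a t A B) (ddB a t A B)); auto;
      intros u Hu.
    - now apply (continuous_of_is_derive _ (dddA a t A B)), is_derive_ddA.
    - now apply (continuous_of_is_derive _ (dddB a t A B)), is_derive_ddB. }
  assert (Ck2 : forall x y, 0 < x -> 0 < y -> continuity_2d_pt k2 x y).
  { intros x y Hx Hy.
    apply (kern_form_continuous a t A B DA DB 2 (dddA a t A B) (dddB a t A B)); auto;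
      intros u Hu.
    - now apply continuous_dddA.
    - now apply continuous_dddB. }
  assert (Dk : forall x y, 0 < x -> 0 < y -> is_derive (fun u => k u y) x (k1 x y)).
  { intros x y Hx Hy.
    apply (kern_form_is_derive A B 0 (dA a t A B) (ddA a t A B) (dB a A B) (ddB a t A B));
      auto; intros u Hu.
    - now apply is_derive_dA.
    - now apply is_derive_dB.
    - now apply (continuous_of_is_derive _ (dddA a t A B)), is_derive_ddA.
    - now apply (continuous_of_is_derive _ (dddB a t A B)), is_derive_ddB. }
  assert (Dk1 : forall x y, 0 < x -> 0 < y -> is_derive (fun u => k1 u y) x (k2 x y)).
  { intros x y Hx Hy.
    apply (kern_form_is_derive A B 1 (ddA a t A B) (dddA a t A B) (ddB a t A B) (dddB a t A B));
      auto; intros u Hu.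
    - now apply is_derive_ddA.
    - now apply is_derive_ddB.
    - now apply continuous_dddA.
    - now apply continuous_dddB. }
  assert (Sk : forall x y, 0 < x -> 0 < y -> k x y = k y x)
    by (intros x y Hx Hy; now apply (kern_sym a t A B DA DB)).
  assert (SG : forall x y, 0 < x -> 0 < y ->
    sturm_liouville_kernel k k1 k2 qr tau x y = sturm_liouville_kernel k k1 k2 qr tau y x)
    by (intros x y Hx Hy; now apply (sturm_liouville_kernel_kern_sym a t A B DA DB)).
  assert (Cq : forall x, 0 < x -> continuous qr x).
  { intros x Hx. apply (ex_derive_continuous (V := R_NormedModule)). unfold qr.
    auto_derive. lra. }
  assert (SLq : forall f x, 0 < x -> sturm_liouville tau p q f x
    = sturm_liouville tau p (fun x => RtoC (qr x)) f x)
    by (intros f x Hx; unfold sturm_liouville; now rewrite Eq).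
  (* What remains concerns a complex constant times any real kernel with the recorded smoothness and
     the symmetries [Sk] and [SG]. *)
  clearbody k k1 k2 qr.
  clear - Htau EK Ck Ck1 Ck2 Dk Dk1 Sk SG Cq SLq.
  intros f (f1 & f2 & Hf) [X0 Z0].
  destruct (one_sided_C2_extension tau (fun x => fst (f x)) (fun x => fst (f1 x))
    (fun x => fst (f2 x))) as (g & g1 & g2 & Dg & Dg1 & Cg & Eg).
  { intros x Hx. apply (is_derive_from_components tau f x (f1 x)), Hf, Hx. }
  { intros x Hx. apply (is_derive_from_components tau f1 x (f2 x)), Hf, Hx. }
  { intros x Hx. apply (filterlim_C_components f2 _ (f2 x)), Hf, Hx. }
  destruct (one_sided_C2_extension tau (fun x => snd (f x)) (fun x => snd (f1 x))
    (fun x => snd (f2 x))) as (h & h1 & h2 & Dh & Dh1 & Ch & Eh).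
  { intros x Hx. apply (is_derive_from_components tau f x (f1 x)), Hf, Hx. }
  { intros x Hx. apply (is_derive_from_components tau f1 x (f2 x)), Hf, Hx. }
  { intros x Hx. apply (filterlim_C_components f2 _ (f2 x)), Hf, Hx. }
  assert (Ef : forall x, tau <= x -> f x = (g x, h x)).
  { intros x Hx. rewrite (Eg x Hx), (Eh x Hx). apply surjective_pairing. }
  clear Hf.
  (* The derivatives of [f] are known to vanish only strictly beyond [X]; the shift by [1] makes the
     boundary terms at [M] vanish. *)
  set (X := Rmax X0 tau). set (M := X + 1).
  assert (HX : X0 <= X /\ tau <= X) by (split; [apply Rmax_l|apply Rmax_r]).
  assert (HM : tau <= M) by (unfold M; lra).
  assert (Zg : forall y, X < y -> g y = 0)
    by (intros y Hy; rewrite Eg, Z0 by lra; reflexivity).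
  assert (Zh : forall y, X < y -> h y = 0)
    by (intros y Hy; rewrite Eh, Z0 by lra; reflexivity).
  pose proof (derivative_eventually_zero g g1 X Dg Zg) as Zg1.
  pose proof (derivative_eventually_zero g1 g2 X Dg1 Zg1) as Zg2.
  pose proof (derivative_eventually_zero h h1 X Dh Zh) as Zh1.
  pose proof (derivative_eventually_zero h1 h2 X Dh1 Zh1) as Zh2.
  (* With [c = cr + i ci] and [f = g + i h], the product [c f] has real part [comb cr (- ci) g h]
     and imaginary part [comb ci cr g h]. The constant is thus absorbed into the function, and the
     kernel stays real. *)
  set (comb := fun (r s : R) (u v : R -> R) (y : R) => r * u y + s * v y).
  assert (Dcomb : forall r s u v u1 v1, (forall y, is_derive u y (u1 y)) ->
    (forall y, is_derive v y (v1 y)) ->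
    forall y, is_derive (comb r s u v) y (comb r s u1 v1 y)).
  { intros r s u v u1 v1 Du Dv y.
    apply (is_derive_plus (V := R_NormedModule) (fun y => r * u y) (fun y => s * v y));
      now apply is_derive_scal. }
  assert (Ccomb : forall r s y, continuous (comb r s g h) y)
    by (intros r s y; apply (continuous_of_is_derive _ (comb r s g1 h1)); auto).
  assert (Ccomb2 : forall r s y, continuous (comb r s g2 h2) y).
  { intros r s y. apply continuous_Rplus; apply continuous_Rmult; auto;
      apply continuous_const. }
  assert (Zcomb : forall r s u v, (forall y, X < y -> u y = 0) -> (forall y, X < y -> v y = 0) ->
    forall y, M <= y -> comb r s u v y = 0).
  { intros r s u v Zu Zv y Hy. unfold comb. unfold M in Hy. rewrite Zu, Zv by lra. ring. }
  set (cr := fst c). set (ci := snd c).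
  set (F := fun k x => (integral_op tau M k (comb cr (- ci) g h) x,
                        integral_op tau M k (comb ci cr g h) x) : C).
  assert (Op : forall x, 0 < x -> @is_RInt_gen C_R_NormedModule
    (fun y => (whittaker_kernel W z z' x y * f y)%C) (at_point tau) (Rbar_locally p_infty) (F k x)).
  { intros x Hx.
    apply (is_RInt_gen_eventually_zero _ (fun y => k x y * comb cr (- ci) g h y)
      (fun y => k x y * comb ci cr g h y) tau M); [exact HM| | | |].
    - intros y Hy. rewrite EK, Ef by lra. unfold comb, cr, ci, Cmult, RtoC; simpl. f_equal; ring.
    - intros y Hy. rewrite !Zcomb by assumption. split; ring.
    - apply (RInt_correct (V := R_CompleteNormedModule)). now apply integral_op_ex_RInt.
    - apply (RInt_correct (V := R_CompleteNormedModule)). now apply integral_op_ex_RInt. }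
  assert (Esl : forall y, tau <= y ->
    sturm_liouville tau p q f y = (sturm_liouville_real qr tau g g1 g2 y, sturm_liouville_real qr tau h h1 h2 y)).
  { intros y Hy. rewrite SLq by lra. apply sturm_liouville_components; auto. }
  (* This is [D] applied to the integral of [k] against [h], differentiated under the integral sign;
     Green's formula produces the same expression from the integral of [k] against [D h]. *)
  set (G := fun h x => (2 * x - tau) * integral_op tau M k1 h x
    + x * (x - tau) * integral_op tau M k2 h x + qr x * integral_op tau M k h x).
  assert (Osl : forall x, 0 < x -> @is_RInt_gen C_R_NormedModule
    (fun y => (whittaker_kernel W z z' x y * sturm_liouville tau p q f y)%C)
    (at_point tau) (Rbar_locally p_infty) (G (comb cr (- ci) g h) x, G (comb ci cr g h) x)).
  { intros x Hx.
    apply (is_RInt_gen_eventually_zero _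
      (fun y => k x y * sturm_liouville_real qr tau (comb cr (- ci) g h) (comb cr (- ci) g1 h1)
                  (comb cr (- ci) g2 h2) y)
      (fun y => k x y * sturm_liouville_real qr tau (comb ci cr g h) (comb ci cr g1 h1)
                  (comb ci cr g2 h2) y) tau M); [exact HM| | | |].
    - intros y Hy. rewrite EK, Esl by lra.
      unfold sturm_liouville_real, comb, cr, ci, Cmult, RtoC; simpl. f_equal; ring.
    - intros y Hy. unfold sturm_liouville_real. rewrite !Zcomb by assumption. split; ring.
    - apply integral_op_sturm_liouville with (kx := k1) (kxx := k2); auto; apply Zcomb; auto; lra.
    - apply integral_op_sturm_liouville with (kx := k1) (kxx := k2); auto; apply Zcomb; auto; lra. }
  assert (PF : ProperFilter' (Rbar_locally p_infty))
    by apply (Proper_StrongProper _ (Rbar_locally_filter p_infty)).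
  assert (PT : ProperFilter' (at_point tau))
    by apply (Proper_StrongProper _ (at_point_filter tau)).
  assert (Eop : forall x, 0 < x -> restricted_op tau (whittaker_kernel W z z') f x = F k x)
    by (intros x Hx; apply (is_RInt_gen_unique (V := C_R_CompleteNormedModule)); now apply Op).
  assert (DF : forall k0 k01,
    (forall x y, 0 < x -> 0 < y -> continuity_2d_pt k0 x y) ->
    (forall x y, 0 < x -> 0 < y -> continuity_2d_pt k01 x y) ->
    (forall x y, 0 < x -> 0 < y -> is_derive (fun u => k0 u y) x (k01 x y)) ->
    forall r s x, tau <= x ->
    is_derive (integral_op tau M k0 (comb r s g h)) x (integral_op tau M k01 (comb r s g h) x)).
  { intros k0 k01 C0 C1 D0 r s x Hx. apply is_derive_integral_op; auto. lra. }
  split; [|split; [|split]].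
  - intros x Hx. exists (F k x). apply Op. lra.
  - intros x Hx. exists (G (comb cr (- ci) g h) x, G (comb ci cr g h) x). apply Osl. lra.
  - exists (F k1), (F k2). intros x Hx. split; [|split].
    + apply (is_derive_from_two_sided tau _ (integral_op tau M k (comb cr (- ci) g h))
        (integral_op tau M k (comb ci cr g h))); auto.
      intros y Hy. apply Eop. lra.
    + apply (is_derive_from_two_sided tau _ (integral_op tau M k1 (comb cr (- ci) g h))
        (integral_op tau M k1 (comb ci cr g h))); auto.
    + apply (filterlim_filter_le_1 (G := within (Rle tau) (locally x)) (F := locally x));
        [apply filter_le_within|].
      apply filterlim_C_components; [apply locally_filter|].
      split; apply integral_op_continuous; auto; lra.
  - intros x Hx. rewrite SLq by lra.
    rewrite (sturm_liouville_components tau qr _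
      (integral_op tau M k (comb cr (- ci) g h)) (integral_op tau M k1 (comb cr (- ci) g h))
      (integral_op tau M k2 (comb cr (- ci) g h))
      (integral_op tau M k (comb ci cr g h)) (integral_op tau M k1 (comb ci cr g h))
      (integral_op tau M k2 (comb ci cr g h))); auto.
    + apply (is_RInt_gen_unique (V := C_R_CompleteNormedModule)). apply Osl. lra.
    + intros y Hy. apply Eop. lra.
Qed.
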